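(* Let $X=(X,d)$ be an ultrametric Polish space such that $R(d)$ is either finite or the range of a strictly decreasing $\omega$-sequence converging to $0$. Then the $\mathsf L(d)$-hierarchy on the Borel subsets of $X$ is very good.
   Context: Work in ZF + DC($\mathbb{R}$). An ultrametric Polish space is a separable metric space $(X,d)$ with $d$ a complete ultrametric; $R(d)=\{d(x,y):x\neq y\}$. $\mathsf L(d)$: maps $f\colon X\to X$ with $d(f(x),f(y))\le d(x,y)$. $A\le B$ iff $A=f^{-1}(B)$ for some $f\in\mathsf L(d)$; $A<B$ iff $A\le B$ and $B\not\le A$; $\neg A=X\setminus A$. The hierarchy on Borel sets is very good if (i) for all Borel $A,B$, $A\le B$ or $\neg B\le A$, and (ii) there is no sequence of Borel sets with $A_{n+1}<A_n$ for all $n$. *)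

(* Defs.v *)
From mathcomp Require Import all_boot all_order all_algebra.
From mathcomp Require Import boolp classical_sets functions cardinality.
From mathcomp Require Import reals topology normedtype sequences measure.

Set Implicit Arguments.
Unset Strict Implicit.
Unset Printing Implicit Defensive.

Import Order.TTheory GRing.Theory Num.Theory.
Import numFieldNormedType.Exports.

Local Open Scope classical_set_scope.
Local Open Scope ring_scope.

Section Polish.
Context {R : realType} (X : metricType R).

Definition separable := exists2 D : set X, countable D & dense D.

Definition is_ultrametric :=
  forall x y z : X, mdist x z <= Num.max (mdist x y) (mdist y z).

(* The library's completeType is pointed; this predicate also covers the
   empty space. *)
Definition is_complete :=
  forall u : nat -> X, cauchy (u @ \oo) -> exists l : X, u @ \oo --> l.

Definition ultrametric_Polish :=
  [/\ separable, is_ultrametric & is_complete].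

(* R(d) *)
Definition nonzero_distances : set R :=
  [set r | exists x y : X, x <> y /\ r = mdist x y].

(* L(d) *)
Definition nonexpansive : set (X -> X) :=
  [set f | forall x y : X, mdist (f x) (f y) <= mdist x y].

Definition Borel : set (set X) := <<s @open X >>.

End Polish.

Arguments nonzero_distances {R} X _.
Arguments nonexpansive {R} X _.
Arguments Borel {R} X _.

Section Hierarchy.
Context {X : Type} (F : set (X -> X)).

Definition reducible (A B : set X) := exists2 f, F f & A = f @^-1` B.

Definition strictly_reducible (A B : set X) :=
  reducible A B /\ ~ reducible B A.

Definition very_good (Gamma : set (set X)) :=
  (forall A B, Gamma A -> Gamma B -> reducible A B \/ reducible (~` B) A) /\
  ~ (exists A : nat -> set X,
       (forall n, Gamma (A n)) /\
       (forall n, strictly_reducible (A n.+1) (A n))).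

End Hierarchy.

(* Main.v *)
Require Import Defs.
From mathcomp Require Import all_boot all_order all_algebra.
From mathcomp Require Import boolp classical_sets functions cardinality.
From mathcomp Require Import reals topology normedtype sequences measure.
From mathcomp Require Import zify.

Set Implicit Arguments.
Unset Strict Implicit.
Unset Printing Implicit Defensive.

(** The closed balls of radius [r n], where [r] lists the distances in decreasing
order, turn [X] into the set of branches of a tree, and the nonexpansive maps
into the level-preserving tree maps.  Both players build a branch in the
Lipschitz game of [A] and [B]; a winning strategy of player II is a nonexpansive
reduction of [A] to [B], and one of player I is a reduction of the complement of
[B] to [A] that even gains one level.  The game is Borel, hence determined: this
is Martin's theorem, proved by unravelling.  A covering of a game tree lets
strategies be pushed down and plays be lifted back; an open payoff set becomes
clopen in a suitable covering, and inverse limits of coverings handle countable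
unions, so every Borel payoff becomes clopen.

Well-foundedness is the Martin-Monk argument.  Along a descending sequence
player I wins the games of [A n] against [A n.+1] and against its complement.
Choosing one of the two strategies at each [n] by a bit [z n], and composing
these contractions, gives a point depending continuously on [z]; its membership
in [A 0] is reversed when a single bit of [z] is flipped, which is impossible for
a set with the Baire property. *)

(** * Game trees and coverings *)

(** [par] is total: at the root its value has level 0 again, hence is the root. By [child_ex] the
    tree is pruned, so strategies can be total functions on positions. *)
Record game := Game {
  pos :> Type;
  lev : pos -> nat;
  par : pos -> pos;
  root : pos;
  lev_root : lev root = 0;
  lev0 : forall v, lev v = 0 -> v = root;
  lev_par : forall v, lev (par v) = (lev v).-1;
  child_ex : forall v, exists w, par w = v /\ lev w = (lev v).+1 }.

Arguments root {g}.

Lemma first_hit (Q : nat -> Prop) l n : l <= n -> Q n ->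
  exists m, [/\ l <= m, Q m & forall j, l <= j < m -> ~ Q j].
Proof.
move=> ln Qn.
have H : exists n, (l <= n) && `[<Q n>] by exists n; rewrite ln; apply/asboolP.
case: (ex_minnP H) => m /andP[lm /asboolP Qm] minm; exists m; split=> // j /andP[lj jm] Qj.
by have := minm j; rewrite lj /= leqNgt jm => /(_ (introT (asboolP _) Qj)).
Qed.

Section Games.
Variable G : game.
Implicit Types (v w u r : G) (x y : nat -> G) (s : G -> G) (p : bool).
Implicit Types (D S : G -> Prop).

Definition child v w := par w = v /\ lev w = (lev v).+1.
Definition play x := forall n, lev (x n) = n /\ par (x n.+1) = x n.
Definition strat s := forall v, child v (s v).
(** Player [false] moves from the even levels and so begins; player [true] moves from the odd
    ones. *)
Definition follows p s x := forall n, odd n = p -> x n.+1 = s (x n).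
Definition res m v := iter (lev v - m) (@par G) v.
Definition above r v := res (lev r) v = r.

Lemma play_lev x n : play x -> lev (x n) = n.
Proof. by move=> /(_ n) []. Qed.

Lemma play_child x n : play x -> child (x n) (x n.+1).
Proof. by move=> px; split; [case: (px n) | rewrite !play_lev]. Qed.

Lemma lev_iter_par n v : lev (iter n (@par G) v) = lev v - n.
Proof. by elim: n => [|n IH] /=; rewrite ?subn0 // lev_par IH subnS. Qed.

Lemma res_id m v : lev v <= m -> res m v = v.
Proof. by rewrite /res -subn_eq0 => /eqP ->. Qed.

Lemma lev_res m v : lev (res m v) = minn m (lev v).
Proof. by rewrite lev_iter_par; lia. Qed.

Lemma res_child m v w : child v w -> m <= lev v -> res m w = res m v.
Proof.
move=> [<- lw]; rewrite lev_par => lm.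
rewrite /res lev_par -iterSr; congr iter; lia.
Qed.

Lemma res_res m n v : m <= n -> res m (res n v) = res m v.
Proof.
move=> mn; rewrite {1}/res lev_res /res -iterD; congr iter; lia.
Qed.

Lemma par_res v : par v = res (lev v).-1 v.
Proof.
rewrite /res; case: (posnP (lev v)) => [l0|lp].
  by rewrite l0 /=; rewrite (lev0 l0); apply: lev0; rewrite lev_par lev_root.
by have -> : lev v - (lev v).-1 = 1 by lia.
Qed.

Lemma child_res v w : child v w -> v = res (lev v) w.
Proof. by case=> vw lw; rewrite -vw lev_par -par_res. Qed.

Lemma play_res x m n : play x -> m <= n -> res m (x n) = x m.
Proof.
move=> px; elim: n => [|n IH] mn.
  by rewrite res_id ?play_lev //; congr x; lia.
case: (ltngtP m n.+1) mn => // [mn|->] _; last by rewrite res_id ?play_lev.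
by rewrite (res_child (play_child n px)) ?play_lev ?IH.
Qed.

Definition dflt v : G := sval (cid (child_ex v)).

Lemma dflt_strat : strat dflt.
Proof. by move=> v; rewrite /dflt; case: cid. Qed.

(** The strategy is obeyed only from [v] on, whereas the visit to [D] may come earlier; for this
    reason [pursue_play] asks that [D] lie at levels at least [l]. *)
Definition force p D v := exists s, strat s /\
  forall x, play x -> x (lev v) = v ->
    (forall m, lev v <= m -> odd m = p -> x m.+1 = s (x m)) ->
    exists m, D (x m).

Lemma force_target p D v : D v -> force p D v.
Proof.
move=> Dv; exists dflt; split; first exact: dflt_strat.
by move=> x _ xv _; exists (lev v); rewrite xv.
Qed.

Lemma force_own p D v w :
  odd (lev v) = p -> child v w -> force p D w -> force p D v.
Proof.
move=> ov vw [s [ss sw]].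
exists (fun u => if pselect (u = v) then w else s u); split.
  by move=> u; case: pselect => /= [->|_]; [exact: vw | exact: ss].
move=> x px xv fx; have lw : lev w = (lev v).+1 by case: vw.
apply: sw => //.
  by rewrite lw fx // xv; case: pselect.
move=> m lm om; rewrite fx //; last by lia.
by case: pselect => /= // E; move: (play_lev m px); rewrite E; lia.
Qed.

(** One strategy is chosen for each child of [v]; a later position [u] finds its own through the
    ancestor [res (lev v).+1 u]. *)
Lemma force_opp p D v :
  odd (lev v) <> p -> (forall w, child v w -> force p D w) -> force p D v.
Proof.
move=> ov fw.
have [w|f Pf] := @choice G (G -> G) (fun w s => child v w -> strat s /\
    forall x, play x -> x (lev w) = w ->
    (forall m, lev w <= m -> odd m = p -> x m.+1 = s (x m)) ->
    exists m, D (x m)).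
  case: (pselect (child v w)) => [vw|nvw]; last by exists dflt.
  by have [s ?] := fw w vw; exists s.
exists (fun u => let w := res (lev v).+1 u in
  if pselect (child v w) then f w u else dflt u); split.
  move=> u /=; case: pselect => /= [cw|_]; last exact: dflt_strat.
  by case: (Pf _ cw) => + _; apply.
move=> x px xv fx.
have cw : child v (x (lev v).+1) by rewrite -{1}xv; apply: play_child.
have [_] := Pf _ cw; apply=> //; first by rewrite play_lev.
move=> m lm om; rewrite play_lev // in lm; rewrite fx //; last by lia.
by rewrite /= play_res //; case: pselect.
Qed.

Definition fstrat p D v : G -> G :=
  if pselect (force p D v) is left h then sval (cid h) else dflt.

Lemma fstrat_strat p D v : strat (fstrat p D v).
Proof.
rewrite /fstrat; case: pselect => [h|_]; last exact: dflt_strat.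
by case: cid => s /= [].
Qed.

Lemma fstratP p D v x : force p D v -> play x -> x (lev v) = v ->
  (forall m, lev v <= m -> odd m = p -> x m.+1 = fstrat p D v (x m)) ->
  exists m, D (x m).
Proof.
move=> fv; rewrite /fstrat; case: pselect => // h.
by case: cid => s /= [_]; apply.
Qed.

(** A quasistrategy for [p] from [r] inside [S0]: it may restrict the moves of [p], keeping at least
    one, but excludes no move of the opponent that stays in [S0]. *)
Definition quasi p r (S0 S : G -> Prop) :=
  [/\ S r,
      forall v, S v -> S0 v /\ above r v,
      forall v w, child v w -> lev r <= lev v -> S w -> S v,
      forall v, S v -> odd (lev v) = p -> exists2 w, child v w & S w
    & forall v w, S v -> odd (lev v) <> p -> child v w -> S0 w -> S w].

Lemma above_lev r v : above r v -> lev r <= lev v.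
Proof. by move=> /(congr1 (@lev G)); rewrite lev_res; lia. Qed.

Lemma above_child r v w : child v w -> lev r <= lev v -> above r w <-> above r v.
Proof. by move=> vw rv; rewrite /above (res_child vw). Qed.

Lemma above_refl r : above r r.
Proof. exact: res_id. Qed.

Definition safe p D r (S0 : G -> Prop) v :=
  [/\ S0 v, above r v & forall m, lev r <= m -> ~ force p D (res m v)].

(** Where [p] cannot force [D], every move of [p] and some move of the opponent preserve this, by
    [force_own] and [force_opp]. The result is the non-losing quasistrategy of Gale and Stewart for
    the opponent. *)
Lemma safe_quasi p D r S0 : S0 r -> ~ force p D r ->
  (forall v w, child v w -> lev r <= lev v -> S0 w -> S0 v) ->
  (forall v w, S0 v -> odd (lev v) <> p -> child v w -> S0 w) ->
  quasi (~~ p) r S0 (safe p D r S0).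
Proof.
move=> S0r nfr S0p S0c.
have safe_child v w : safe p D r S0 v -> child v w -> S0 w ->
    ~ force p D w -> safe p D r S0 w.
  move=> [Sv av nf] vw Sw nfw; have lrv := above_lev av.
  split=> //; first exact/(above_child vw lrv).
  move=> m rm; case: (leqP m (lev v)) => mv.
    by rewrite (res_child vw) //; apply: nf.
  by rewrite res_id // (proj2 vw).
split.
- split=> //; first exact: above_refl.
  by move=> m rm; rewrite res_id.
- by move=> v [].
- move=> v w vw rv [Sw aw nf]; split; first exact: S0p (vw) _ _.
    exact/(above_child vw rv).
  move=> m rm; case: (leqP m (lev v)) => mv.
    by rewrite -(res_child vw) //; apply: nf.
  by rewrite res_id ?(ltnW mv) // (child_res vw); apply: nf.
- move=> v Sv ov; have [S0v av nf] := Sv.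
  have ovp : odd (lev v) <> p by rewrite ov; case: (p).
  apply: contrapT => H; apply: (nf (lev v)); first exact: above_lev.
  rewrite res_id //; apply: force_opp => // w vw.
  apply: contrapT => nfw; apply: H; exists w => //.
  by apply: safe_child (vw) _ _ => //; apply: S0c vw.
- move=> v w Sv ov vw Sw; apply: safe_child (vw) _ _ => //.
  have [S0v av nf] := Sv => fw.
  apply: (nf (lev v)); first exact: above_lev.
  rewrite res_id //; apply: force_own vw fw.
  by move: ov; case: (odd _); case: (p).
Qed.

Definition isfirst D l v u := exists m,
  [/\ l <= m <= lev v, u = res m v, D u & forall j, l <= j < m -> ~ D (res j v)].

(** A strategy in three phases: [g2] while [D] cannot be forced, then the forcing strategy of the
    first position from which it can, then [g1] for the first position visited in [D]. The phase is
    read off from the ancestors of [v]. *)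
Definition pursue p l D (g1 : G -> G -> G) (g2 : G -> G) v :=
  if pselect (exists u, isfirst D l v u) is left h then g1 (sval (cid h)) v
  else if pselect (exists u, isfirst (force p D) l v u) is left h
       then fstrat p D (sval (cid h)) v
  else g2 v.

Lemma isfirst_play D l x m u : play x -> isfirst D l (x m) u <->
  exists n, [/\ l <= n <= m, u = x n, D u & forall j, l <= j < n -> ~ D (x j)].
Proof.
move=> px; split=> -[n [/andP[ln nm] ue Du nD]]; exists n.
  rewrite play_lev // in nm; rewrite play_res // in ue.
  split=> // [|j /andP[lj jn]]; first by rewrite ln.
  by have := nD j; rewrite play_res ?lj //; [exact | lia].
rewrite play_lev // play_res //; split=> // [|j /andP[lj jn]]; first by rewrite ln.
by rewrite play_res //; [apply: nD; rewrite lj | lia].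
Qed.

Lemma isfirst_uniq D l v u1 u2 : isfirst D l v u1 -> isfirst D l v u2 -> u1 = u2.
Proof.
move=> [m [/andP[lm mv] -> Du nD]] [n [/andP[ln nv] -> Dn nDn]].
case: (ltngtP m n) => [mn|nm|->] //.
  by case: (nDn m); rewrite ?lm.
by case: (nD n); rewrite ?ln.
Qed.

Lemma pursue_strat p l D g1 g2 v : (forall u, child v (g1 u v)) ->
  child v (g2 v) -> child v (pursue p l D g1 g2 v).
Proof.
move=> h1 h2; rewrite /pursue; case: pselect => // _.
by case: pselect => // *; apply: fstrat_strat.
Qed.

(** If [D] is never entered, then it is never forceable either: the first forceable position would
    put [fstrat] in charge, and that strategy reaches [D]. *)
Lemma pursue_play p l D g1 g2 x : play x -> (forall v, D v -> l <= lev v) ->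
  (forall m, l <= m -> odd m = p -> x m.+1 = pursue p l D g1 g2 (x m)) ->
  (exists n, [/\ l <= n, D (x n), (forall j, l <= j < n -> ~ D (x j)) &
     forall m, n <= m -> odd m = p -> x m.+1 = g1 (x n) (x m)]) \/
  ((forall n, l <= n -> ~ force p D (x n)) /\
   forall m, l <= m -> odd m = p -> x m.+1 = g2 (x m)).
Proof.
move=> px Dl fx.
have [[n ln Dn]|nD] := pselect (exists2 n, l <= n & D (x n)).
  left; have [n0 [ln0 Dn0 nD]] := first_hit (Q := fun n => D (x n)) ln Dn.
  exists n0; split=> // m nm om.
  have F : isfirst D l (x m) (x n0).
    by apply/isfirst_play => //; exists n0; split=> //; rewrite ln0.
  rewrite fx //; last by lia.
  rewrite /pursue; case: pselect => [h|[]]; last by exists (x n0).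
  by case: cid => u /= /isfirst_uniq /(_ F) ->.
right.
have nfirst m : ~ exists u, isfirst D l (x m) u.
  move=> [u /(isfirst_play _ _ _ _ px) [n [/andP[ln nm] ue Du _]]].
  by apply: nD; exists n; rewrite -?ue.
have nforce n : l <= n -> ~ force p D (x n).
  move=> ln fn; have [n0 [ln0 Fn0 nF]] := first_hit (Q := fun n => force p D (x n)) ln fn.
  have [||m Dm] := fstratP Fn0 px.
  - by rewrite play_lev.
  - move=> m; rewrite play_lev // => nm om; rewrite fx //; last by lia.
    have F : isfirst (force p D) l (x m) (x n0).
      by apply/isfirst_play => //; exists n0; split=> //; rewrite ln0.
    rewrite /pursue; case: pselect => [h|_]; first by case: (nfirst _ h).
    case: pselect => [h|[]]; last by exists (x n0).
    by case: cid => u /= /isfirst_uniq /(_ F) ->.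
  - apply: nD; exists m => //; by rewrite -(play_lev m px); apply: Dl.
split=> // m lm om; rewrite fx // /pursue.
case: pselect => [h|_]; first by case: (nfirst _ h).
case: pselect => // h; have [u /(isfirst_play _ _ _ _ px) [n [/andP[ln nm] ue Du _]]] := h.
by case: (nforce n) => //; rewrite -ue.
Qed.

Definition open_set (A : (nat -> G) -> Prop) := forall x, play x -> A x ->
  exists n, forall y, play y -> y n = x n -> A y.
Definition clopen_set (A : (nat -> G) -> Prop) := forall x, play x ->
  exists n, forall y, play y -> y n = x n -> (A y <-> A x).

Definition determined (A : (nat -> G) -> Prop) :=
  (exists2 s, strat s & forall x, play x -> follows false s x -> A x) \/
  (exists2 s, strat s & forall x, play x -> follows true s x -> ~ A x).

Lemma open_determined A : open_set A -> determined A.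
Proof.
move=> oA.
pose D v := forall x, play x -> x (lev v) = v -> A x.
have play0 x : play x -> x 0 = root by move=> px; apply: lev0; apply: play_lev.
have [fr|nfr] := pselect (force false D root).
  left; exists (fstrat false D root); first exact: fstrat_strat.
  move=> x px fx; have [|m lm om|m Dm] := fstratP fr px.
  - by rewrite lev_root play0.
  - exact: fx.
  - by apply: Dm => //; rewrite play_lev.
right; pose S := safe false D root (fun=> True).
have [Sr _ _ Sown Sopp] : quasi true root (fun=> True) S by apply: safe_quasi.
pose s v := if pselect (exists2 w, child v w & S w) is left h then s2val (cid2 h)
  else dflt v.
exists s.
  move=> v; rewrite /s; case: pselect => [h|_]; last exact: dflt_strat.
  by case: cid2.
move=> x px fx Ax; have [n oAn] := oA x px Ax.
have Sx m : S (x m).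
  elim: m => [|m IH]; first by rewrite play0.
  case om : (odd m).
    rewrite fx // /s; case: pselect => [h|[]]; first by case: cid2.
    by apply: Sown => //; rewrite play_lev.
  by apply: Sopp (play_child m px) _ => //; rewrite play_lev // om.
have [_ _ /(_ n)] := Sx n; rewrite lev_root res_id ?play_lev // => /(_ isT); apply.
apply: force_target => y py; rewrite play_lev // => yn; exact: oAn.
Qed.

End Games.

(** Martin's [k]-coverings. The two trees agree through level [k] by [cmap_inj], [cmap_surj] and
    [cstr_id]; [cstr_local] makes it possible to push a strategy through infinitely many coverings;
    [cstr_lift] carries winning strategies down. *)
Record covering (k : nat) (G' G : game) := Covering {
  cmap :> G' -> G;
  cstr : bool -> (G' -> G') -> (G -> G);
  cmap_lev : forall v, lev (cmap v) = lev v;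
  cmap_par : forall v, cmap (par v) = par (cmap v);
  cmap_inj : forall v w, lev v <= k -> lev w <= k -> cmap v = cmap w -> v = w;
  cmap_surj : forall v, lev v <= k -> exists w, cmap w = v;
  cstr_strat : forall p s, strat s -> strat (cstr p s);
  cstr_local : forall p s t n, strat s -> strat t ->
    (forall v, lev v < n -> s v = t v) ->
    forall v, lev v < n -> cstr p s v = cstr p t v;
  cstr_id : forall p s v, strat s -> lev v < k -> cstr p s (cmap v) = cmap (s v);
  cstr_lift : forall p s x, strat s -> play x -> follows p (cstr p s) x ->
    exists y, [/\ play y, follows p s y & forall n, cmap (y n) = x n] }.

Definition morph (G' G : game) (f : G' -> G) :=
  (forall v, lev (f v) = lev v) /\ (forall v, f (par v) = par (f v)).

Lemma covering_morph k G' G (c : covering k G' G) : morph c.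
Proof. by split; [exact: cmap_lev | exact: cmap_par]. Qed.

Lemma morph_comp (G2 G1 G0 : game) (f : G1 -> G0) (g : G2 -> G1) :
  morph f -> morph g -> morph (f \o g).
Proof. by move=> [fl fp] [gl gp]; split=> v /=; rewrite ?fl ?gp ?fp. Qed.

Lemma morph_play (G' G : game) (f : G' -> G) x : morph f -> play x -> play (f \o x).
Proof. by move=> [fl fp] px n /=; rewrite fl -fp; case: (px n) => -> ->. Qed.

Lemma morph_child (G' G : game) (f : G' -> G) v w :
  morph f -> child v w -> child (f v) (f w).
Proof. by move=> [fl fp] [<- lw]; split; rewrite ?fl // fp. Qed.

Lemma covering_comp k k' G2 G1 G0 (c : covering k G1 G0) (d : covering k' G2 G1) :
  k <= k' -> exists e : covering k G2 G0, forall v, e v = c (d v).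
Proof.
move=> kk.
unshelve eexists (@Covering k G2 G0 (c \o d) (fun p => cstr c p \o cstr d p)
  _ _ _ _ _ _ _ _) => //=.
- by move=> v /=; rewrite !cmap_lev.
- by move=> v /=; rewrite !cmap_par.
- move=> v w lv lw /= /cmap_inj; rewrite !cmap_lev => /(_ lv lw).
  by apply: cmap_inj; apply: leq_trans kk.
- move=> v lv; have [w wv] := cmap_surj c lv.
  have [|u uw] := cmap_surj d (v := w); first by rewrite -(cmap_lev c) wv; lia.
  by exists u; rewrite /= uw.
- by move=> p s ss /=; do 2!apply: cstr_strat.
- move=> p s t n ss tt st v lv /=; apply: cstr_local lv; try exact: cstr_strat.
  exact: cstr_local.
- move=> p s v ss lv /=; rewrite cstr_id ?cstr_id //; try exact: cstr_strat.
    by apply: leq_trans kk.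
  by rewrite cmap_lev.
- move=> p s x ss px /= fx.
  have [y [py fy yx]] := cstr_lift (cstr_strat d p ss) px fx.
  have [z [pz fz zy]] := cstr_lift ss py fy.
  by exists z; split=> // n; rewrite zy yx.
Qed.

(** * Inverse limits of coverings *)

Definition thread (G : nat -> game) (K : nat -> nat)
    (c : forall i, covering (K i) (G i.+1) (G i)) (t : forall i, G i) :=
  forall i, c i (t i.+1) = t i.

(** As [K] is nondecreasing, every [c i] is onto at the level of [w], so [w] is lifted through one
    covering after another. *)
Lemma thread_ex0 (G : nat -> game) (K : nat -> nat)
    (c : forall i, covering (K i) (G i.+1) (G i)) (w : G 0) :
  {homo K : i j / i <= j} -> lev w <= K 0 ->
  exists2 t, thread c t & t 0 = w.
Proof.
move=> hK lw.
pose up i (v : G i) : G i.+1 :=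
  if pselect (exists u, c i u = v) is left h then sval (cid h) else root.
pose t : forall i, G i := nat_rect (fun i => G i) w up.
have upP i (v : G i) : lev v <= K i -> c i (up i v) = v.
  move=> lv; rewrite /up; case: pselect => [h|[]]; first by case: cid.
  exact: cmap_surj.
have lt i : lev (t i) = lev w.
  elim: i => // i IH; rewrite -IH -(cmap_lev (c i)) upP // IH.
  by apply: leq_trans lw _; apply: hK.
exists t => // i; apply: upP; rewrite lt; apply: leq_trans lw _; exact: hK.
Qed.

Lemma thread_ex (G : nat -> game) (K : nat -> nat)
    (c : forall i, covering (K i) (G i.+1) (G i)) j (w : G j) :
  {homo K : i j / i <= j} -> lev w <= K j ->
  exists2 t, thread c t & t j = w.
Proof.
elim: j => [|j IH] in G K c w *; first exact: thread_ex0.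
move=> hK lw.
have [||t tt tw] := IH (fun i => G i.+1) (fun i => K i.+1) (fun i => c i.+1) w.
- by move=> a b ab; apply: hK.
- by [].
exists (fun i => if i is i'.+1 then t i' else c 0 (t 0)) => //.
by case=> // i; apply: tt.
Qed.

Section Limit.
Variables (G : nat -> game) (K : nat -> nat).
Variable c : forall i, covering (K i) (G i.+1) (G i).
Hypothesis homoK : {homo K : i j / i <= j}.
Hypothesis geK : forall i, i <= K i.

Definition lim_pos := {t : forall i, G i | thread c t}.
Definition lim_proj i (t : lim_pos) : G i := sval t i.

Lemma lim_projS i t : c i (lim_proj i.+1 t) = lim_proj i t.
Proof. by case: t. Qed.

Lemma lim_pos_eq (t u : lim_pos) :
  (forall i, lim_proj i t = lim_proj i u) -> t = u.
Proof.
case: t u => t tt [u uu] tu; apply: eq_exist.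
by apply: functional_extensionality_dep => i; apply: tu.
Qed.

Definition lim_lev (t : lim_pos) := lev (lim_proj 0 t).

Lemma lev_proj i t : lev (lim_proj i t) = lim_lev t.
Proof. by elim: i => // i <-; rewrite -(lim_projS i) cmap_lev. Qed.

(** Coordinates below [j] are images of coordinate [j]; beyond [j] each covering is injective at the
    levels concerned. *)
Lemma lim_pos_inj j t u : lim_lev t <= K j -> lim_lev u <= K j ->
  lim_proj j t = lim_proj j u -> t = u.
Proof.
move=> lt lu tu; apply: lim_pos_eq.
have down i : i <= j -> lim_proj i t = lim_proj i u.
  move=> ij; rewrite -(subKn ij); elim: (j - i) => [|d IH]; first by rewrite subn0.
  case: (leqP j d) => jd; first by have -> : j - d.+1 = j - d by lia.
  have E : j - d = (j - d.+1).+1 by lia.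
  by rewrite E in IH; rewrite -(lim_projS _ t) -(lim_projS _ u) IH.
move=> i; elim: i => [|i IH]; first exact: down.
case: (leqP i.+1 j) => ij; first exact: down.
have lK : K j <= K i by apply: homoK; lia.
by apply: (cmap_inj (c := c i)); rewrite ?lev_proj ?lim_projS //; apply: leq_trans lK.
Qed.

Lemma lim_proj_surj j (w : G j) : lev w <= K j -> exists t, lim_proj j t = w.
Proof. by move=> lw; have [t tt tw] := thread_ex c homoK lw; exists (exist _ t tt). Qed.

Definition lim_par (t : lim_pos) : lim_pos.
Proof.
by exists (fun i => par (sval t i)) => i; rewrite cmap_par; case: t => t /= ->.
Defined.

Definition lim_root : lim_pos.
Proof. by exists (fun i => root) => i; apply: lev0; rewrite cmap_lev lev_root. Defined.

Lemma lim_lev_root : lim_lev lim_root = 0.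
Proof. exact: lev_root. Qed.

Lemma lim_lev0 t : lim_lev t = 0 -> t = lim_root.
Proof. by move=> t0; apply: lim_pos_eq => i; apply: lev0; rewrite lev_proj. Qed.

Lemma lim_lev_par t : lim_lev (lim_par t) = (lim_lev t).-1.
Proof. exact: lev_par. Qed.

Lemma lim_child_ex t : exists u, lim_par u = t /\ lim_lev u = (lim_lev t).+1.
Proof.
pose j := (lim_lev t).+1.
have [w [pw lw]] := child_ex (lim_proj j t).
rewrite lev_proj in lw.
have [|u uw] := @lim_proj_surj j w; first by rewrite lw; apply: geK.
have lu : lim_lev u = (lim_lev t).+1 by rewrite -(lev_proj j) uw lw.
exists u; split=> //; have lK : lim_lev t < K j by apply: (geK j).
apply: (@lim_pos_inj j); rewrite ?lim_lev_par ?lu //; try exact: ltnW.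
by rewrite -pw -uw.
Qed.

Definition lim_game := Game lim_lev_root lim_lev0 lim_lev_par lim_child_ex.

Lemma lim_proj_morph i : morph (lim_proj i : lim_game -> G i).
Proof. by split=> v //; apply: lev_proj. Qed.

Section Strategies.
Variable p : bool.
Implicit Type s : lim_game -> lim_game.

(** At levels below [K j] the limit tree looks like [G j], so [s] can be read there directly;
    elsewhere the default move is taken. *)
Definition lim_stage s j (v : G j) : G j :=
  if pselect (exists2 t, lim_proj j t = v & lev v < K j) is left h
  then lim_proj j (s (s2val (cid2 h))) else dflt v.

(** The stage strategy on the tree of index [i + d], pushed down through [d] coverings. *)
Fixpoint lim_down s d i : G i -> G i :=
  if d is d'.+1 then cstr (c i) p (lim_down s d' (i := i.+1)) else lim_stage s (j := i).

(** The limit of [lim_down] as the number of coverings grows: by [geK] the value at [v] is stable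
    from [(lev v).+1] coverings on. *)
Definition lim_str s i (v : G i) := lim_down s (lev v).+1 v.

Lemma lim_stage_strat s j : strat s -> strat (lim_stage s (j := j)).
Proof.
move=> ss v; rewrite /lim_stage; case: pselect => [h|_]; last exact: dflt_strat.
case: cid2 => t /= tv _; rewrite -tv.
exact/(morph_child (lim_proj_morph j))/ss.
Qed.

Lemma lim_stageE s j t : lim_lev t < K j ->
  lim_stage s (lim_proj j t) = lim_proj j (s t).
Proof.
move=> lt; rewrite /lim_stage; case: pselect => [h|[]]; last first.
  by exists t; rewrite ?lev_proj.
case: cid2 => u /= ut _; congr (lim_proj j (s _)).
by apply: lim_pos_inj (ut); rewrite ltnW // -(lev_proj j) ut lev_proj.
Qed.

Lemma lim_down_strat s d i : strat s -> strat (lim_down s d (i := i)).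
Proof.
move=> ss; elim: d => [|d IH] in i *; first exact: lim_stage_strat.
exact: cstr_strat.
Qed.

Lemma lim_str_strat s i : strat s -> strat (lim_str s (i := i)).
Proof. by move=> ss v; apply: lim_down_strat. Qed.

(** At low levels [cstr_id] turns the stage strategy of one tree into that of the tree below;
    [cstr_local] carries this agreement down the remaining coverings. *)
Lemma lim_down_step s d i n : strat s -> n <= K (i + d) ->
  forall v : G i, lev v < n -> lim_down s d.+1 v = lim_down s d v.
Proof.
move=> ss; elim: d => [|d IH] in i n *.
  rewrite addn0 => nK v vn /=.
  have [|t tv] := @lim_proj_surj i v; first by apply: leq_trans nK; apply: ltnW.
  have lt : lim_lev t < K i by rewrite -(lev_proj i) tv; apply: leq_trans nK.
  have lt' : lim_lev t < K i.+1 by apply: leq_trans lt _; apply: homoK.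
  rewrite -tv lim_stageE // -lim_projS cstr_id ?lim_stageE ?lim_projS //.
    exact: lim_stage_strat.
  by rewrite lev_proj.
rewrite addnS -addSn => nK v vn.
apply: (@cstr_local _ _ _ (c i) p _ _ n) => //; try exact: (lim_down_strat _.+1).
  exact: lim_down_strat.
exact: IH.
Qed.

Lemma lim_down_stable s d e i n : strat s -> n <= K (i + d) -> d <= e ->
  forall v : G i, lev v < n -> lim_down s e v = lim_down s d v.
Proof.
move=> ss nK de v vn; rewrite -(subnKC de).
elim: (e - d) => [|f IH]; first by rewrite addn0.
rewrite addnS (lim_down_step (n := n)) //; apply: leq_trans nK _; apply: homoK; lia.
Qed.

Lemma lim_strE s i d (v : G i) : strat s -> lev v < d -> lim_str s v = lim_down s d v.
Proof.
move=> ss vd; rewrite /lim_str; symmetry.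
apply: (lim_down_stable (n := (lev v).+1)) => //.
by apply: leq_trans (geK _) _; apply: homoK; lia.
Qed.

Lemma lim_str_cstr s i (v : G i) : strat s ->
  cstr (c i) p (lim_str s (i := i.+1)) v = lim_str s v.
Proof.
move=> ss; rewrite (@lim_strE s i (lev v).+2) //=.
apply: (@cstr_local _ _ _ (c i) p _ _ (lev v).+1) => //.
- exact: lim_str_strat.
- exact: (@lim_down_strat s (lev v).+1).
- by move=> w lw; apply: (@lim_strE s i.+1 (lev v).+1).
Qed.

Lemma lim_str_stage s i (v : G i) : strat s -> lev v < K i ->
  lim_str s v = lim_stage s v.
Proof.
by move=> ss lv; rewrite /lim_str (@lim_down_stable s 0 _ i (K i)) // addn0.
Qed.

Lemma lim_down_local s t n d i : strat s -> strat t ->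
  (forall v, lev v < n -> s v = t v) ->
  forall v : G i, lev v < n -> lim_down s d v = lim_down t d v.
Proof.
move=> ss tt st; elim: d => [|d IH] in i * => v vn /=.
  rewrite /lim_stage; case: pselect => // h; case: cid2 => u /= uv _.
  by rewrite st //; move: vn; rewrite -uv lev_proj.
apply: (@cstr_local _ _ _ (c i) p _ _ n) => //; try exact: lim_down_strat.
exact: IH.
Qed.

Lemma lim_str_local s t n i : strat s -> strat t ->
  (forall v, lev v < n -> s v = t v) ->
  forall v : G i, lev v < n -> lim_str s v = lim_str t v.
Proof. by move=> ss tt st v; apply: lim_down_local. Qed.

Lemma lim_str_lift s x : strat s -> play x -> follows p (lim_str s (i := 0)) x ->
  exists y, [/\ play y, follows p s y & forall n, lim_proj 0 (y n) = x n].
Proof.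
move=> ss px fx.
pose Q i (z : nat -> G i) := play z /\ follows p (lim_str s (i := i)) z.
have step i (z : {z | Q i z}) : exists z' : {z' | Q i.+1 z'},
    forall n, c i (sval z' n) = sval z n.
  case: z => z [pz fz].
  have fz' : follows p (cstr (c i) p (lim_str s (i := i.+1))) z.
    by move=> n on; rewrite fz // lim_str_cstr.
  have [y [py fy yz]] := cstr_lift (lim_str_strat ss) pz fz'.
  by exists (exist _ y (conj py fy)).
pose z : forall i, {z | Q i z} :=
  nat_rect (fun i => {z | Q i z}) (exist _ x (conj px fx))
    (fun i z => sval (cid (step i z))).
have zS i n : c i (sval (z i.+1) n) = sval (z i) n by rewrite /=; case: cid.
pose y n : lim_game := exist (thread c) (fun i => sval (z i) n) (fun i => zS i n).
have py : play y.
  move=> n; split; first by rewrite /lev /= /lim_lev /=; apply: play_lev.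
  by apply: lim_pos_eq => i; case: (svalP (z i)) => /(_ n) [].
exists y; split=> // n on.
(* The move at level [n] is compared in coordinate [n.+1], which is injective at both levels
   involved and where [lim_str] is still the stage strategy. *)
have lK : n.+1 <= K n.+1 by [].
have ly m : lim_lev (y m) = m by apply: play_lev py.
have ls : lim_lev (s (y n)) = n.+1 by have [_] := ss (y n); rewrite /lev /= ly.
apply: (@lim_pos_inj n.+1); rewrite ?ly ?ls //.
rewrite -lim_stageE ?ly // -lim_str_stage ?lev_proj ?ly //.
by have [_] := svalP (z n.+1); apply.
Qed.

End Strategies.

Lemma limit_covering k : k <= K 0 ->
  exists e : covering k lim_game (G 0), forall t, e t = lim_proj 0 t.
Proof.
move=> kK.
unshelve eexists (@Covering k lim_game (G 0) (@lim_proj 0)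
  (fun p s => @lim_str p s 0) _ _ _ _ _ _ _ _) => //=.
- by move=> t u lt lu; apply: lim_pos_inj; apply: leq_trans kK.
- by move=> v lv; apply: lim_proj_surj; apply: leq_trans kK.
- by move=> p s ss; apply: lim_str_strat.
- by move=> p s t n ss tt st; apply: lim_str_local.
- move=> p s v ss lv; have lv' : lim_lev v < K 0 by apply: leq_trans kK.
  by rewrite lim_str_stage ?lim_stageE.
- by move=> p s x; apply: lim_str_lift.
Qed.

End Limit.

(** * Unravelling open sets *)

Lemma child_par (G : game) (w : G) : 0 < lev w -> child (par w) w.
Proof. by move=> lw; split=> //; rewrite lev_par; lia. Qed.

Lemma child_res_res (G : game) (u : G) n : n < lev u -> child (res n u) (res n.+1 u).
Proof.
move=> nu; have l1 : lev (res n.+1 u) = n.+1 by rewrite lev_res; lia.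
have -> : res n u = par (res n.+1 u) by rewrite par_res l1 res_res.
by apply: child_par; rewrite l1.
Qed.

Lemma quasi_res (G : game) p (r : G) S0 Q v n : quasi p r S0 Q -> Q v ->
  lev r <= n -> Q (res n v).
Proof.
move=> [_ _ Sp _ _] Sv rn.
case: (leqP (lev v) n) => vn; first by rewrite res_id.
suff H m : n <= m -> m <= lev v -> Q (res m v) -> Q (res n v).
  by apply: (H (lev v)) => //; [exact: ltnW | rewrite res_id].
elim: m => [|m IH] nm mv Sm; first by have -> : n = 0 by lia.
case: (ltngtP n m.+1) nm => // [nm _|-> //].
apply: IH => //; first by lia.
by apply: Sp (child_res_res _) _ Sm; rewrite // ?lev_res; lia.
Qed.

Lemma pursue_ext (G : game) p l D (g1 h1 : G -> G -> G) g2 h2 v :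
  (forall u, g1 u v = h1 u v) -> g2 v = h2 v ->
  pursue p l D g1 g2 v = pursue p l D h1 h2 v.
Proof. by move=> e1 e2; rewrite /pursue e2; case: pselect. Qed.

Section Unravel.
Variables (G : game) (B : (nat -> G) -> Prop) (oB : open_set B) (k : nat).
Implicit Types (v w u r : G) (Q : G -> Prop).

Let b := odd k.
Let all_pos : G -> Prop := fun=> True.

(** The positions at which membership in [B] is already secured; since [B] is open, every play in
    [B] reaches one. *)
Definition dead v := forall x, play x -> x (lev v) = v -> B x.

Lemma play_dead x : play x -> B x -> forall m, exists2 n, m <= n & dead (x n).
Proof.
move=> px Bx m; have [n nB] := oB px Bx.
exists (maxn m n); first exact: leq_maxl.
move=> y py; rewrite play_lev // => yx; apply: nB => //.
by rewrite -(play_res py (leq_maxr m n)) yx play_res // leq_maxr.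
Qed.

(* The code records the extra moves of Martin's auxiliary game: with move [k] the
   player [b] also proposes a quasistrategy [Q] for the rest of the game; with
   move [k.+1] the opponent either names a position [u] of [Q] at which the play
   will enter [B] for good ([Departure]), or commits to a quasistrategy [Q'] of
   his own inside [Q] along which [B] is avoided ([Confinement]).  Hence the
   code at level [k.+2] decides [B]. *)
Inductive code := Initial | Proposal of G -> Prop | Departure of (G -> Prop) & G
  | Confinement of (G -> Prop) & (G -> Prop).

(** The equation for [Departure] says that [v] and [u] are comparable in the tree: the play must run
    to [u] and is free afterwards. *)
Definition legal v c : Prop := match c with
  | Initial => lev v <= k
  | Proposal Q => lev v = k.+1 /\ quasi b v all_pos Q
  | Departure Q u => [/\ k.+2 <= lev v, quasi b (res k.+1 v) all_pos Q, Q u /\ dead u,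
      k.+2 <= lev u & res (lev u) v = res (lev v) u]
  | Confinement Q Q' => [/\ k.+2 <= lev v, quasi b (res k.+1 v) all_pos Q,
      quasi (~~ b) (res k.+2 v) Q Q', Q' v
      & forall x, play x -> (forall n, k.+2 <= n -> Q' (x n)) -> ~ B x]
  end.

(** The part of the code that has been announced by level [n]; it is the code of the ancestor at
    that level. *)
Definition trunc n c := match c with
  | Initial => Initial
  | Proposal Q => if n <= k then Initial else Proposal Q
  | Departure Q u =>
      if n <= k then Initial else if n <= k.+1 then Proposal Q else Departure Q u
  | Confinement Q Q' =>
      if n <= k then Initial else if n <= k.+1 then Proposal Q else Confinement Q Q'
  end.

Lemma trunc_high n c : k.+1 < n -> trunc n c = c.
Proof.
move=> kn; have kn' : k < n by lia.
by case: c => //= *; rewrite ?(leqNgt n) ?kn ?kn'.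
Qed.

Lemma trunc_low n c : n <= k -> trunc n c = Initial.
Proof. by move=> nk; case: c => //= *; rewrite nk. Qed.

Lemma trunc_trunc m n c : m <= n -> trunc m (trunc n c) = trunc m c.
Proof.
move=> mn; case: c => [|Q|Q u|Q Q'] //=.
- by case: (leqP n k) => nk //=; case: (leqP m k) => // ?; exfalso; lia.
- case: (leqP n k) => nk //=; first by case: (leqP m k) => // ?; exfalso; lia.
  case: (leqP n k.+1) => nk1 //=.
  by case: (leqP m k) => // mk; case: (leqP m k.+1) => // ?; exfalso; lia.
- case: (leqP n k) => nk //=; first by case: (leqP m k) => // ?; exfalso; lia.
  case: (leqP n k.+1) => nk1 //=.
  by case: (leqP m k) => // mk; case: (leqP m k.+1) => // ?; exfalso; lia.
Qed.

Lemma legal_low v c : legal v c -> lev v <= k -> c = Initial.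
Proof. by case: c => [|Q|Q u|Q Q'] //= [lv *]; lia. Qed.

Lemma legal_trunc v c n : legal v c -> n <= lev v -> legal (res n v) (trunc n c).
Proof.
move=> lc nv; have ln : lev (res n v) = n by rewrite lev_res; lia.
have [nk|kn] := leqP n k.
  by rewrite trunc_low //= ln.
case: c lc => [|Q|Q u|Q Q'] /=.
- by lia.
- move=> [lv q]; have E : n = k.+1 by lia.
  by rewrite leqNgt kn /= E -lv res_id.
- move=> [lv q Su lu uv]; rewrite leqNgt kn /=.
  case: (leqP n k.+1) => nk /=.
    by (have E : n = k.+1 by lia); split; [rewrite ln | rewrite E].
  split; rewrite ?ln //; first by rewrite res_res // ltnW.
  case: (leqP n (lev u)) => nu.
    by rewrite res_id ?ln // -[in LHS](res_res _ nu) uv res_res.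
  by rewrite res_res 1?ltnW // uv !res_id //; lia.
- move=> [lv q q' Sv pS]; rewrite leqNgt kn /=.
  case: (leqP n k.+1) => nk /=.
    by (have E : n = k.+1 by lia); split; [rewrite ln | rewrite E].
  split; rewrite ?ln //; try by rewrite res_res // ltnW.
  by apply: quasi_res q' Sv _; rewrite lev_res; lia.
Qed.

Lemma above_quasi p r : quasi p r all_pos (above r).
Proof.
split=> //; first exact: above_refl.
- by move=> v w vw rv /(above_child vw rv).
- move=> v av _; exists (dflt v); first exact: dflt_strat.
  exact/(above_child (dflt_strat v) (above_lev av)).
- by move=> v w av _ vw _; apply/(above_child vw (above_lev av)).
Qed.

(** The auxiliary tree is pruned. The trivial quasistrategy can always be proposed; the answer is a
    departure if [Q] has a dead position above [w], and otherwise confinement to the part of [Q]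
    above [w], which then avoids [B]. *)
Lemma legal_child_ex v c : legal v c ->
  exists w c', [/\ child v w, legal w c' & trunc (lev v) c' = c].
Proof.
case: c => [|Q|Q u|Q Q'] /=.
- rewrite leq_eqVlt => /orP[/eqP lv|lv]; have dv := dflt_strat v.
    exists (dflt v), (Proposal (above (dflt v))); split=> //=; last by rewrite lv leqnn.
    by split; [rewrite (proj2 dv) lv | exact: above_quasi].
  by exists (dflt v), Initial; split=> //=; rewrite (proj2 dv).
- move=> [lv q]; have [Sv Sa Sp So Sc] := q.
  have vw := dflt_strat v; set w := dflt v in vw.
  have lw : lev w = k.+2 by rewrite (proj2 vw) lv.
  have ob : odd (lev v) <> b by rewrite lv /= -/b; case: (b).
  have Sw : Q w by apply: Sc vw _.
  have rw1 : res k.+1 w = v by rewrite (res_child vw) ?lv // res_id ?lv.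
  have [[u [Su du lu aw]]|nu] :=
    pselect (exists u, [/\ Q u, dead u, k.+2 <= lev u & above w u]).
    exists w, (Departure Q u); split=> //=; last by rewrite lv leqnn leqNgt ltnSn.
    by split=> //; [rewrite lw | rewrite rw1 | rewrite aw res_id // lw].
  exists w, (Confinement Q (fun u => Q u /\ above w u)); split=> //=; last first.
    by rewrite lv leqnn leqNgt ltnSn.
  have aww := above_refl w.
  split=> //; rewrite ?lw ?rw1 ?res_id ?lw //.
    split=> //.
    - move=> y z yz; rewrite lw => ly [Sz az]; split.
        by apply: Sp yz _ Sz; rewrite lv; lia.
      by apply/(above_child yz _); rewrite ?lw.
    - move=> y [Sy ay] oy; have yz := dflt_strat y.
      exists (dflt y) => //; split; last exact/(above_child yz (above_lev ay)).
      by apply: Sc yz _ => //; rewrite oy; case: (b).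
    - move=> y z [Sy ay] _ yz Sz; split=> //.
      exact/(above_child yz (above_lev ay)).
  move=> x px xS Bx; apply: nu.
  have [n kn dn] := play_dead px Bx k.+2; exists (x n).
  by have [? ?] := xS n kn; split=> //; rewrite play_lev.
- move=> [lv q Su lu uv].
  case: (ltnP (lev v) (lev u)) => vu.
    have rv : res (lev v) u = v by rewrite -uv res_id // ltnW.
    have ch := child_res_res vu; rewrite rv in ch.
    exists (res (lev v).+1 u), (Departure Q u); split=> //; last by rewrite trunc_high.
    have lw : lev (res (lev v).+1 u) = (lev v).+1 by rewrite lev_res; lia.
    split=> //; first by lia.
      by rewrite (res_child ch) //; lia.
    by rewrite lw res_id // lw.
  have ch := dflt_strat v; have lw := proj2 ch.
  exists (dflt v), (Departure Q u); split=> //; last by rewrite trunc_high.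
  split=> //; first by lia.
    by rewrite (res_child ch) //; lia.
  by rewrite (res_child ch) // uv !res_id ?lw //; lia.
- move=> [lv q q' Sv pS].
  have [w vw Sw] : exists2 w, child v w & Q' w.
    have [_ Q'a _ Q'o Q'c] := q'; have [_ _ _ So _] := q.
    have [ov|ov] := eqVneq (odd (lev v)) (~~ b); first exact: Q'o.
    have ov' : odd (lev v) = b by move: ov; case: (odd _); case: (b).
    have [w vw Sw] := So v (proj1 (Q'a v Sv)) ov'.
    by exists w => //; apply: Q'c vw Sw => //; apply/eqP.
  have lw := proj2 vw.
  exists w, (Confinement Q Q'); split=> //; last by rewrite trunc_high.
  by split=> //; rewrite ?(res_child vw) //; lia.
Qed.

Definition upos := {t : G * code | legal t.1 t.2}.
Definition mkpos v c (h : legal v c) : upos := exist (fun t => legal t.1 t.2) (v, c) h.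

Lemma upos_eq (t t' : upos) : sval t = sval t' -> t = t'.
Proof. by case: t t' => t h [t' h'] /= tt; apply: eq_exist. Qed.

Definition ulev (t : upos) := lev (sval t).1.

Lemma upar_subproof (t : upos) :
  legal (par (sval t).1) (trunc (ulev t).-1 (sval t).2).
Proof.
case: t => -[v c] /= h; rewrite par_res; apply: legal_trunc => //.
by rewrite /ulev /=; lia.
Qed.

Definition upar (t : upos) : upos := mkpos (upar_subproof t).

Lemma uroot_subproof : legal root Initial.
Proof. by rewrite /= lev_root. Qed.

Definition uroot : upos := mkpos uroot_subproof.

Lemma ulev_root : ulev uroot = 0.
Proof. exact: lev_root. Qed.

Lemma ulev0 t : ulev t = 0 -> t = uroot.
Proof.
case: t => -[v c] h; rewrite /ulev /= => l0; apply: upos_eq => /=.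
by rewrite (lev0 l0) (legal_low (h : legal v c)) // l0.
Qed.

Lemma ulev_par t : ulev (upar t) = (ulev t).-1.
Proof. exact: lev_par. Qed.

Lemma uchild_ex t : exists t', upar t' = t /\ ulev t' = (ulev t).+1.
Proof.
case: t => -[v c] /= h; have [w [c' [[pw lw] h' tr]]] := legal_child_ex h.
exists (mkpos h'); split; last by [].
by apply: upos_eq; rewrite /= /ulev /= lw pw tr.
Qed.

Definition ugame := Game ulev_root ulev0 ulev_par uchild_ex.

(** The two halves of the move of [s] at the pair of [v] and [c]; the default at illegal pairs keeps
    [act] a move of [G]. *)
Definition act (s : ugame -> ugame) v c : G :=
  if pselect (legal v c) is left h then (sval (s (mkpos h))).1 else dflt v.
Definition answer (s : ugame -> ugame) v c : code :=
  if pselect (legal v c) is left h then (sval (s (mkpos h))).2 else Initial.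

Lemma act_child s v c : strat s -> child v (act s v c).
Proof.
move=> ss; rewrite /act; case: pselect => [h|_]; last exact: dflt_strat.
have [pw lw] := ss (mkpos h); split; last exact: lw.
exact: (congr1 (fun t => (sval t).1) pw).
Qed.

Lemma answerP s v c : strat s -> legal v c ->
  legal (act s v c) (answer s v c) /\ trunc (lev v) (answer s v c) = c.
Proof.
move=> ss lc; rewrite /act /answer; case: pselect => // h.
split; first exact: (svalP (s (mkpos h))).
have [pw lw] := ss (mkpos h).
have := congr1 (fun t => (sval t).2) pw => /=.
by have -> : ulev (s (mkpos h)) = (lev v).+1 by [].
Qed.

Lemma act_answerE s v c (h : legal v c) :
  sval (s (mkpos h)) = (act s v c, answer s v c).
Proof.
rewrite /act /answer; case: pselect => // h'.
by rewrite (Prop_irrelevance h h'); case: (sval _).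
Qed.

Lemma act_local s t n v c : (forall y, lev y < n -> s y = t y) -> lev v < n ->
  act s v c = act t v c.
Proof. by move=> st vn; rewrite /act; case: pselect => // h; rewrite st. Qed.

Lemma answer_local s t n v c : (forall y, lev y < n -> s y = t y) -> lev v < n ->
  answer s v c = answer t v c.
Proof. by move=> st vn; rewrite /answer; case: pselect => // h; rewrite st. Qed.

Lemma legal_play x c m : play x -> (forall n, m <= n -> legal (x n) (trunc n c)) ->
  forall n, legal (x n) (trunc n c).
Proof.
move=> px H n; case: (leqP m n) => mn; first exact: H.
have := legal_trunc (n := n) (H m (leqnn m)).
by rewrite play_lev // play_res 1?ltnW // trunc_trunc 1?ltnW //; apply.
Qed.

(** Only the moves from levels [k] and [k.+1] choose a part of the code; at all others legality or
    truncation determines it, so only these two have to be compared with [s]. *)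
Lemma lift_play p s x c : strat s -> play x ->
  (forall n, legal (x n) (trunc n c)) ->
  (forall n, odd n = p -> x n.+1 = act s (x n) (trunc n c)) ->
  (forall n, odd n = p -> k <= n <= k.+1 -> answer s (x n) (trunc n c) = trunc n.+1 c) ->
  exists y : nat -> ugame, [/\ play y, follows p s y & forall n, (sval (y n)).1 = x n].
Proof.
move=> ss px lx ax cx.
pose y n : ugame := mkpos (lx n); exists y; split=> //.
  move=> n; split; first exact: (play_lev n px).
  apply: upos_eq => /=; rewrite /ulev /= play_lev //= trunc_trunc //.
  by rewrite (proj2 (px n)).
move=> n on; apply: upos_eq => /=; rewrite act_answerE -ax //; congr pair.
have [lc tc] := answerP ss (lx n); rewrite -ax // in lc.
have [nk|kn] := ltnP n k.
  have l1 : lev (x n.+1) <= k by rewrite play_lev.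
  by rewrite (legal_low lc l1) (legal_low (lx n.+1) l1).
have [nk|kn1] := leqP n k.+1; first by rewrite cx // kn.
rewrite play_lev // trunc_high // in tc.
by rewrite tc !trunc_high // ltnW.
Qed.

Lemma legal_departure_play x Q n : play x -> quasi b (x k.+1) all_pos Q -> Q (x n) ->
  dead (x n) -> k.+2 <= n -> forall m, legal (x m) (trunc m (Departure Q (x n))).
Proof.
move=> px q Sn dn kn; apply: (@legal_play _ _ k.+2) => // m km.
rewrite trunc_high //.
split; rewrite ?play_lev //.
  by rewrite play_res //; lia.
case: (leqP n m) => nm; first by rewrite play_res // res_id // play_lev.
by rewrite res_id ?play_lev ?play_res 1?ltnW.
Qed.

(* Before the promised position [x n] is reached, the only legal move is the
   one towards it. *)
Lemma act_departure s x Q n m : strat s -> play x ->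
  legal (x m) (Departure Q (x n)) -> k.+2 <= m < n ->
  act s (x m) (Departure Q (x n)) = x m.+1.
Proof.
move=> ss px lm /andP[km mn]; have [l1 t1] := answerP ss lm.
have E : answer s (x m) (Departure Q (x n)) = Departure Q (x n).
  by move: t1; rewrite play_lev // trunc_high.
rewrite E in l1; have [_ _ _ _] := l1.
have [_ la] := act_child (x m) (Departure Q (x n)) ss.
rewrite la !play_lev // play_res // res_id // la play_lev //.
Qed.

(** * Pushing down a strategy of the proposing player *)

Section Mover.
Variable s : ugame -> ugame.

Definition proposal r : G -> Prop :=
  if answer s r Initial is Proposal Q then Q else fun=> False.

Definition refuted Q u := [/\ Q u, dead u & k.+2 <= lev u].

(** The opponent's auxiliary answer is missing in [G] and is supplied: confinement to the positions
    safe from [refuted Q] as long as that set cannot be forced, and departure to the first refuted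
    position once it is reached. *)
Definition mover_str v : G :=
  if lev v <= k then act s v Initial else
  let Q := proposal (res k v) in
  pursue b k.+2 (refuted Q) (fun u w => act s w (Departure Q u))
    (fun w => act s w (Confinement Q (safe b (refuted Q) (res k.+2 w) Q))) v.

Lemma mover_strat : strat s -> strat mover_str.
Proof.
move=> ss v; rewrite /mover_str; case: leqP => _; first exact: act_child.
by apply: pursue_strat => *; apply: act_child.
Qed.

Lemma mover_lift x : strat s -> play x -> follows b mover_str x ->
  exists y : nat -> ugame, [/\ play y, follows b s y & forall n, (sval (y n)).1 = x n].
Proof.
move=> ss px fx.
have fx0 n : n <= k -> odd n = b -> x n.+1 = act s (x n) Initial.
  by move=> nk on; rewrite fx // /mover_str play_lev // nk.
have lk : legal (x k) Initial by rewrite /= play_lev.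
have [Q ES [lk1 q]] :
    exists2 Q, answer s (x k) Initial = Proposal Q & legal (x k.+1) (Proposal Q).
  have [l1 _] := answerP ss lk; rewrite -fx0 // in l1.
  case: (answer s (x k) Initial) l1 => [|Q|Q u|Q Q'] /=; rewrite play_lev //.
  - by lia.
  - by move=> ?; exists Q => //=; rewrite play_lev.
  - by case; lia.
  - by case; lia.
have [Sr Sa Sp So Sc] := q.
have := @pursue_play G b k.+2 (refuted Q) (fun u w => act s w (Departure Q u))
    (fun w => act s w (Confinement Q (safe b (refuted Q) (res k.+2 w) Q))) x px.
case=> [v []//||[n [kn [Sn dn ln] _ g1]]|[nf g2]].
- move=> m km om; rewrite fx // /mover_str play_lev //.
  case: leqP => [|_]; first by lia.
  by rewrite play_res ?/proposal ?ES //; lia.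
(* The opponent is credited with having named [x n] at move [k.+1]; on the way to [x n] that code
   leaves [s] no other move. *)
- have lc := legal_departure_play px q Sn dn kn.
  apply: (@lift_play _ _ _ (Departure Q (x n))) => // m om.
    have [mk|km] := leqP m k; first by rewrite /= mk; apply: fx0.
    have [mk1|km1] := leqP m k.+1.
      by (have E : m = k.+1 by lia); move: om; rewrite E /= -/b; case: (b).
    have := lc m; rewrite trunc_high //.
    move=> lm; have [nm|mn] := leqP n m; first exact: g1.
    by rewrite act_departure // km1.
  move=> /andP[km mk]; have E : m = k.
    case: (ltngtP m k) km => // km _; have E : m = k.+1 by lia.
    by move: om; rewrite E /= -/b; case: (b).
  by rewrite E /= leqnn ES ltnn leqnn.
(* No refuted position is ever forceable, so the opponent is credited with the confinement to the
   safe positions. It is legal, because a play in [B] inside it would meet a dead position of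
   [Q]. *)
- have k2 : k.+2 <= k.+2 by [].
  have ok1 : odd (lev (x k.+1)) <> b by rewrite play_lev //= -/b; case: (b).
  have Sk2 : Q (x k.+2) by apply: Sc ok1 (play_child _ px) _.
  pose Q' := safe b (refuted Q) (x k.+2) Q.
  have q' : quasi (~~ b) (x k.+2) Q Q'.
    apply: safe_quasi => //; first exact: nf.
      by move=> v w vw; rewrite play_lev // => lv; apply: Sp vw _; rewrite play_lev //; lia.
    by move=> v w Sv ov vw; apply: Sc vw _.
  have Q'x m : k.+2 <= m -> Q (x m) -> Q' (x m).
    move=> km Sm; split=> //; first by rewrite /above play_lev // play_res.
    move=> j; rewrite play_lev // => kj.
    have [jm|mj] := leqP j m; first by rewrite play_res //; apply: nf.
    by rewrite res_id ?play_lev 1?ltnW //; apply: nf.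
  have pS y : play y -> (forall n, k.+2 <= n -> Q' (y n)) -> ~ B y.
    move=> py yS By; have [n kn dn] := play_dead py By k.+2.
    have [Sn _ /(_ n)] := yS n kn.
    rewrite play_lev // res_id ?play_lev // => /(_ kn); apply.
    by apply: force_target; split; rewrite ?play_lev.
  have lm m : k.+2 <= m -> Q (x m) -> legal (x m) (Confinement Q Q').
    by move=> km Sm; split=> //; rewrite ?play_lev // ?play_res //; [lia | exact: Q'x].
  have Sx m : k.+2 <= m -> Q (x m).
    elim: m => // m IH; rewrite leq_eqVlt => /orP[/eqP<- //|km].
    have [om|om] := eqVneq (odd m) b.
      rewrite g2 // play_res //.
      have [l1 t1] := answerP ss (lm m km (IH km)).
      rewrite play_lev // trunc_high // in t1; rewrite t1 in l1.
      by have [_ _ q1 Sa1 _] := l1; case: q1 => _ /(_ _ Sa1) [].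
    by apply: Sc (play_child m px) _ => //; [exact: IH | rewrite play_lev //; apply/eqP].
  have lc : forall m, legal (x m) (trunc m (Confinement Q Q')).
    apply: (@legal_play _ _ k.+2) => // m km.
    rewrite trunc_high //.
    exact: lm (Sx m km).
  apply: (@lift_play _ _ _ (Confinement Q Q')) => // m om.
    have [mk|km] := leqP m k; first by rewrite /= mk; apply: fx0.
    have [mk1|km1] := leqP m k.+1.
      by (have E : m = k.+1 by lia); move: om; rewrite E /= -/b; case: (b).
    by rewrite trunc_high // g2 // play_res.
  move=> /andP[km mk]; have E : m = k.
    case: (ltngtP m k) km => // km _; have E : m = k.+1 by lia.
    by move: om; rewrite E /= -/b; case: (b).
  by rewrite E /= leqnn ES ltnn leqnn.
Qed.

End Mover.

(** * Pushing down a strategy of the answering player *)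

Section Opponent.
Variable s : ugame -> ugame.

(** The departures that [s] would name against some proposal. No proposal is made in [G], so a
    suitable one can be supplied after such a position has been reached. *)
Definition claimed r u :=
  exists Q, legal r (Proposal Q) /\ answer s r (Proposal Q) = Departure Q u.
Definition claim_witness r u : G -> Prop :=
  if pselect (claimed r u) is left h then sval (cid h) else fun=> False.
(** The answer to the quasistrategy of [b] that avoids all claimed positions, used while none of
    them can be forced. *)
Definition reply r := answer s r (Proposal (safe (~~ b) (claimed r) r all_pos)).

Definition opponent_str v : G :=
  if lev v <= k then act s v Initial else
  let r := res k.+1 v in
  pursue (~~ b) k.+1 (claimed r) (fun u w => act s w (Departure (claim_witness r u) u))
    (fun w => act s w (trunc (lev w) (reply r))) v.

Lemma opponent_strat : strat s -> strat opponent_str.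
Proof.
move=> ss v; rewrite /opponent_str; case: leqP => _; first exact: act_child.
by apply: pursue_strat => *; apply: act_child.
Qed.

Lemma claimed_answer r Q u : strat s -> legal r (Proposal Q) ->
  answer s r (Proposal Q) = Departure Q u ->
  [/\ k.+2 <= lev u, Q u, dead u & act s r (Proposal Q) = res k.+2 u].
Proof.
move=> ss lr E; have [l1 _] := answerP ss lr; rewrite E in l1.
have [la _ [Qu du] lu cu] := l1; split=> //.
have [_ lw] := act_child r (Proposal Q) ss.
have lw2 : lev (act s r (Proposal Q)) = k.+2 by rewrite lw (proj1 lr).
by rewrite lw2 res_id ?lw2 in cu.
Qed.

Lemma opponent_lift x : strat s -> play x -> follows (~~ b) opponent_str x ->
  exists y : nat -> ugame,
    [/\ play y, follows (~~ b) s y & forall n, (sval (y n)).1 = x n].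
Proof.
move=> ss px fx.
have ok : odd k <> ~~ b by rewrite -/b; case: (b).
have ok1 : odd k.+1 = ~~ b by [].
have fx0 n : n <= k -> odd n = ~~ b -> x n.+1 = act s (x n) Initial.
  by move=> nk on; rewrite fx // /opponent_str play_lev // nk.
have lr Q : legal (x k.+1) (Proposal Q) <-> quasi b (x k.+1) all_pos Q.
  by rewrite /= play_lev //; split=> [[]|].
have := @pursue_play G (~~ b) k.+1 (claimed (x k.+1))
  (fun u w => act s w (Departure (claim_witness (x k.+1) u) u))
  (fun w => act s w (trunc (lev w) (reply (x k.+1)))) x px.
case=> [v [Q [lQ EQ]]||[n [kn cl _ g1]]|[nf g2]].
- by have [+ _ _ _] := claimed_answer ss lQ EQ; lia.
- move=> m km om; rewrite fx // /opponent_str play_lev //.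
  by rewrite leqNgt km /= play_res.
- set Q := claim_witness _ _ in g1.
  have [lQ EQ] : legal (x k.+1) (Proposal Q) /\
      answer s (x k.+1) (Proposal Q) = Departure Q (x n).
    by rewrite /Q /claim_witness; case: pselect => // h; case: cid.
  have [ln Qn dn an] := claimed_answer ss lQ EQ; rewrite play_lev // in ln.
  have lc := legal_departure_play px (proj1 (lr Q) lQ) Qn dn ln.
  have t1 : trunc k.+1 (Departure Q (x n)) = Proposal Q by rewrite /= ltnn leqnn.
  apply: (@lift_play _ _ _ (Departure Q (x n))) => // m om.
    have [mk|km] := leqP m k; first by rewrite trunc_low //; apply: fx0.
    have [mk1|km1] := leqP m k.+1.
      have -> : m = k.+1 by lia.
      by rewrite t1 an play_res.
    have := lc m; rewrite trunc_high // => lm.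
    have [nm|mn] := leqP n m; first exact: g1.
    by rewrite act_departure // km1.
  move=> /andP[km mk]; have -> : m = k.+1.
    by case: (ltngtP m k) km => // [|E]; [lia | rewrite E in om].
  by rewrite t1 EQ trunc_high.
- have nfr : ~ force (~~ b) (claimed (x k.+1)) (x k.+1) by apply: nf.
  set Q := safe (~~ b) (claimed (x k.+1)) (x k.+1) all_pos.
  have q : quasi b (x k.+1) all_pos Q.
    have := @safe_quasi G (~~ b) (claimed (x k.+1)) (x k.+1) all_pos I nfr.
    by rewrite negbK; apply.
  have lQ : legal (x k.+1) (Proposal Q) by apply/lr.
  have [l2 t2] := answerP ss lQ; rewrite play_lev // in t2.
  have Er : reply (x k.+1) = answer s (x k.+1) (Proposal Q) by [].
  have x2 : x k.+2 = act s (x k.+1) (Proposal Q) by rewrite g2 // Er play_lev // t2.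
  rewrite -x2 in l2.
  (* The answer cannot be a departure: the position named would be claimed, although it lies in [Q],
     which consists of positions safe from claims. *)
  have [Q' E] : exists Q', answer s (x k.+1) (Proposal Q) = Confinement Q Q'.
    case E : (answer s (x k.+1) (Proposal Q)) l2 t2 => [|Q1|Q1 u1|Q1 Q'] //=.
    - by rewrite play_lev //; case; lia.
    - rewrite ltnn leqnn => _ [E1]; rewrite E1 in E.
      have [lu Qu _ _] := claimed_answer ss lQ E.
      case: Qu => _ _ /(_ (lev u1)); rewrite play_lev // res_id // => H.
      by case: H; [lia | apply: force_target; exists Q].
    - by rewrite ltnn leqnn => _ [->]; exists Q'.
  rewrite E in l2 Er; have [_ _ q' Q'2 pQ'] := l2.
  rewrite res_id ?play_lev // in q'.
  have Qx m : k.+1 <= m -> Q (x m).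
    move=> km; split=> //; first by rewrite /above play_lev // play_res.
    move=> j; rewrite play_lev // => kj.
    have [jm|mj] := leqP j m; first by rewrite play_res //; apply: nf.
    by rewrite res_id ?play_lev 1?ltnW //; apply: nf.
  have lm m : k.+2 <= m -> Q' (x m) -> legal (x m) (Confinement Q Q').
    by move=> km Qm; split=> //; rewrite ?play_lev // ?play_res // ltnW.
  have Q'x m : k.+2 <= m -> Q' (x m).
    elim: m => // m IH; rewrite leq_eqVlt => /orP[/eqP<- //|km].
    have [om|om] := eqVneq (odd m) (~~ b).
      rewrite g2 // ?Er ?play_lev ?trunc_high //; last by lia.
      have [l1 t1] := answerP ss (lm m km (IH km)).
      rewrite play_lev // trunc_high // in t1; rewrite t1 in l1.
      by case: l1.
    have [_ _ _ _ Q'c] := q'.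
    apply: Q'c (play_child m px) _ => //; first exact: IH.
      by rewrite play_lev //; apply/eqP.
    by apply: Qx; lia.
  have lc : forall m, legal (x m) (trunc m (Confinement Q Q')).
    apply: (@legal_play _ _ k.+2) => // m km; rewrite trunc_high //.
    exact: lm (Q'x m km).
  apply: (@lift_play _ _ _ (Confinement Q Q')) => // m om.
    have [mk|km] := leqP m k; first by rewrite trunc_low //; apply: fx0.
    by rewrite g2 // Er play_lev.
  move=> /andP[km mk]; have -> : m = k.+1.
    by case: (ltngtP m k) km => // [|E']; [lia | rewrite E' in om].
  by rewrite -[X in trunc k.+1 X]E t2 E trunc_high.
Qed.

End Opponent.

Definition ustr p (s : ugame -> ugame) : G -> G :=
  if p == b then mover_str s else opponent_str s.

Lemma ustr_local p s t n : (forall y, lev y < n -> s y = t y) ->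
  forall v, lev v < n -> ustr p s v = ustr p t v.
Proof.
move=> st v vn; have ea c w : lev w = lev v -> act s w c = act t w c.
  by move=> lw; apply: act_local st _; rewrite lw.
rewrite /ustr; case: eqP => _.
  rewrite /mover_str; case: leqP => kv; first exact: ea.
  have -> : proposal s (res k v) = proposal t (res k v).
    by rewrite /proposal (answer_local _ st) // lev_res; lia.
  by apply: pursue_ext => *; apply: ea.
rewrite /opponent_str; case: leqP => kv; first exact: ea.
have E : answer s (res k.+1 v) = answer t (res k.+1 v).
  by apply: funext => c; apply: answer_local st _; rewrite lev_res; lia.
rewrite /reply /claim_witness /claimed E.
by apply: pursue_ext => *; apply: ea.
Qed.

Lemma unravel_covering : exists c : covering k ugame G, clopen_set (fun y => B (c \o y)).
Proof.
have low (t : ugame) : lev t <= k -> (sval t).2 = Initial.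
  by case: t => -[v c] h lt; apply: legal_low h lt.
unshelve eexists (@Covering k ugame G (fun t => (sval t).1) ustr _ _ _ _ _ _ _ _) => //=.
- move=> t t' lt lt' E; apply: upos_eq.
  by rewrite [LHS]surjective_pairing [RHS]surjective_pairing !low // E.
- by move=> v lv; exists (@mkpos v Initial lv).
- move=> p s ss; rewrite /ustr; case: eqP => _; first exact: mover_strat.
  exact: opponent_strat.
- by move=> p s t n _ _; apply: ustr_local.
- move=> p s t ss lt; have lt' : lev (sval t).1 <= k by apply: ltnW.
  have -> : ustr p s (sval t).1 = act s (sval t).1 Initial.
    by rewrite /ustr; case: eqP => _; rewrite /mover_str /opponent_str ifT.
  have -> : t = @mkpos (sval t).1 Initial lt'.
    by apply: upos_eq; rewrite [LHS]surjective_pairing /= low.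
  by rewrite act_answerE.
- move=> p s x ss px; rewrite /ustr; case: eqP => [->|pb] fx; first exact: mover_lift.
  have Ep : p = ~~ b by move: pb; case: (p); case: (b).
  by rewrite Ep in fx *; apply: opponent_lift.
(* The code is constant from level [k.+2] on. A departure leads the play to a dead position, hence
   into [B]; a confinement keeps it out of [B]. *)
move=> x px; exists k.+2.
have codeE (y : nat -> ugame) n : play y -> k.+2 <= n -> (sval (y n)).2 = (sval (y k.+2)).2.
  move=> py; elim: n => // n IH; rewrite leq_eqVlt => /orP[/eqP<- //|kn].
  rewrite -IH //; have [_ /(congr1 (fun t => (sval t).2)) /= <-] := py n.
  rewrite trunc_high //; have [E _] := py n.+1; by rewrite -[ulev _]/(lev (y n.+1)) E.
have legaly (y : nat -> ugame) n : play y -> k.+2 <= n ->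
    legal (sval (y n)).1 (sval (y k.+2)).2.
  by move=> py kn; rewrite -(codeE y n) //; case: (y n).
have py1 (y : nat -> ugame) : play y -> play (fun n => (sval (y n)).1).
  move=> py n; have [l1 p1] := py n; split; first exact: l1.
  by rewrite -[in RHS]p1.
case E : (sval (x k.+2)).2 => [|Q|Q u|Q Q'].
- by have := legaly x k.+2 px (leqnn _); rewrite E /= (play_lev _ (py1 x px)); lia.
- by have := legaly x k.+2 px (leqnn _); rewrite E /= (play_lev _ (py1 x px)) => -[]; lia.
- suff H (y : nat -> ugame) : play y -> y k.+2 = x k.+2 -> B ((fun t => (sval t).1) \o y).
    by move=> y py yx; split=> _; apply: H.
  move=> py yx; have := legaly y (maxn k.+2 (lev u)) py (leq_maxl _ _).
  rewrite yx E => -[_ _ [_ du] lu]; have py' := py1 y py.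
  rewrite (play_lev _ py') (play_res py') ?leq_maxr // res_id ?leq_maxr // => yu.
  exact: du.
- suff H (y : nat -> ugame) : play y -> y k.+2 = x k.+2 -> ~ B ((fun t => (sval t).1) \o y).
    by move=> y py yx; split=> h; exfalso; [exact: H h | exact: H h].
  move=> py yx; have := legaly y k.+2 py (leqnn _); rewrite yx E => -[_ _ _ _]; apply.
    exact: py1.
  by move=> n kn; have := legaly y n py kn; rewrite yx E => -[].
Qed.

End Unravel.

(** * Borel determinacy *)

(** The quantification over [f] makes the notion hereditary: in a countable union each set is
    unravelled after the earlier coverings have been applied. *)
Definition unravelable (G : game) (A : (nat -> G) -> Prop) :=
  forall (G1 : game) (f : G1 -> G) k, morph f ->
  exists G2 (c : covering k G2 G1), clopen_set (fun y => A (f \o (c \o y))).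

Lemma open_pullback (G' G : game) (f : G' -> G) A : morph f -> open_set A ->
  open_set (fun y => A (f \o y)).
Proof.
move=> mf oA x px Ax; have [n nA] := oA _ (morph_play mf px) Ax.
by exists n => y py yx; apply: nA; [exact: morph_play | rewrite /= yx].
Qed.

Lemma clopen_pullback (G' G : game) (f : G' -> G) A : morph f -> clopen_set A ->
  clopen_set (fun y => A (f \o y)).
Proof.
move=> mf oA x px; have [n nA] := oA _ (morph_play mf px).
by exists n => y py yx; apply: nA; [exact: morph_play | rewrite /= yx].
Qed.

Lemma clopen_setC (G : game) (A : (nat -> G) -> Prop) :
  clopen_set A -> clopen_set (fun y => ~ A y).
Proof.
move=> cA x px; have [n nA] := cA x px; exists n => y py yx.
by split=> h h'; apply: h; apply/(nA y py yx).
Qed.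

Lemma unravelable_open (G : game) (A : (nat -> G) -> Prop) :
  open_set A -> unravelable A.
Proof.
move=> oA G1 f k mf; exists (ugame (open_pullback mf oA) k).
exact: unravel_covering.
Qed.

Lemma unravelable_setC (G : game) (A : (nat -> G) -> Prop) :
  unravelable A -> unravelable (fun y => ~ A y).
Proof.
move=> uA G1 f k mf; have [G2 [c cA]] := uA G1 f k mf.
by exists G2, c; apply: clopen_setC.
Qed.

(** The sets are unravelled one after another; in the inverse limit all become clopen, so their
    union is open and one more covering makes it clopen. *)
Lemma unravelable_bigcup (G : game) (A : nat -> (nat -> G) -> Prop) :
  (forall i, unravelable (A i)) -> unravelable (fun y => exists i, A i y).
Proof.
move=> uA G1 f k mf.
pose stage := {H : game & {g : H -> G | morph g}}.
(* Keeping [k + i] levels at stage [i] provides the growing bounds that the inverse limit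
   requires. *)
pose rel i (h h' : stage) := exists c : covering (k + i) (projT1 h') (projT1 h),
  (forall v, sval (projT2 h') v = sval (projT2 h) (c v)) /\
  clopen_set (fun y => A i (sval (projT2 h') \o y)).
have step i h : exists h', rel i h h'.
  case: h => H [g mg]; have [H' [c cA]] := uA i H g (k + i) mg.
  exists (existT _ H' (exist _ (g \o c) (morph_comp mg (covering_morph c)))).
  by exists c.
pose T : nat -> stage := nat_rect (fun=> stage) (existT _ G1 (exist _ f mf))
  (fun i h => sval (cid (step i h))).
have TP i : rel i (T i) (T i.+1) by rewrite /T /=; case: cid.
pose H i := projT1 (T i).
pose g i : H i -> G := sval (projT2 (T i)).
pose c i : covering (k + i) (H i.+1) (H i) := sval (cid (TP i)).
have cP i : (forall v, g i.+1 v = g i (c i v)) /\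
    clopen_set (fun y => A i (g i.+1 \o y)) by rewrite /c; case: cid.
have hK : {homo addn k : i j / i <= j} by move=> i j; lia.
have gK i : i <= k + i by lia.
have [|e eE] := limit_covering c hK gK (k := k); first by rewrite addn0.
pose L := lim_game c hK gK; pose pr i : L -> H i := @lim_proj H (addn k) c i.
have gpr i v : g i (pr i v) = f (e v).
  by elim: i => [|i <-]; [rewrite eE | rewrite (proj1 (cP i)) lim_projS].
have cl i : clopen_set (fun y => A i (f \o (e \o y))).
  have := clopen_pullback (lim_proj_morph c hK gK i.+1) (proj2 (cP i)).
  congr clopen_set; apply: funext => y; congr (A i _); apply: funext => n.
  exact: gpr.
have op : open_set (fun y => exists i, A i (f \o (e \o y))).
  move=> x px [i Ax]; have [n nA] := cl i x px.
  by exists n => y py yx; exists i; apply/(nA y py yx).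
have [d cd] := unravel_covering op k.
have [e' e'E] := covering_comp e d (leqnn k).
exists (ugame op k), e'; move: cd; congr clopen_set; apply: funext => y.
by congr ex; apply: funext => i; congr (A i _); apply: funext => n /=; rewrite e'E.
Qed.

Lemma unravelable_determined (G : game) (A : (nat -> G) -> Prop) :
  unravelable A -> determined A.
Proof.
move=> uA; have [|G2 [c cA]] := uA G id 0; first by split.
have [|[s ss sA]|[s ss sA]] := @open_determined G2 (fun y => A (c \o y)).
- move=> x px Ax; have [n nA] := cA x px; exists n => y py yx.
  exact/(nA y py yx).
- left; exists (cstr c false s); first exact: cstr_strat.
  move=> x px fx; have [y [py fy yx]] := cstr_lift ss px fx.
  by have -> : x = c \o y; [apply: funext => n; rewrite /= yx | exact: sA].
- right; exists (cstr c true s); first exact: cstr_strat.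
  move=> x px fx; have [y [py fy yx]] := cstr_lift ss px fx.
  by have -> : x = c \o y; [apply: funext => n; rewrite /= yx | exact: sA].
Qed.

Lemma unravelable_setU (G : game) (A B : (nat -> G) -> Prop) :
  unravelable A -> unravelable B -> unravelable (fun y => A y \/ B y).
Proof.
move=> uA uB; have := @unravelable_bigcup G (fun i => if i is 0 then A else B).
have -> : (fun y => exists i, (if i is 0 then A else B) y) = (fun y => A y \/ B y).
  apply: funext => y; apply: propext; split=> [[[|i]]|[]]; [by left|by right| |].
    by exists 0.
  by exists 1.
by apply; case.
Qed.

Lemma unravelable_iff (G : game) (A B : (nat -> G) -> Prop) :
  unravelable A -> unravelable B -> unravelable (fun y => A y <-> B y).
Proof.
move=> uA uB.
have -> : (fun y => A y <-> B y) =
    (fun y => ~ (~ A y \/ ~ B y) \/ ~ (A y \/ B y)).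
  apply: funext => y; apply: propext; split.
    by have [|] := pselect (A y); have [|] := pselect (B y); tauto.
  by have [|] := pselect (A y); have [|] := pselect (B y); tauto.
by apply: unravelable_setU; apply: unravelable_setC; apply: unravelable_setU => //;
  apply: unravelable_setC.
Qed.

(** * Lipschitz games *)

(** The classes of these refining equivalence relations are the nodes of a tree; separation and
    completeness identify [X] with its branches. *)
Record level_structure (X : Type) := LevelStructure {
  lrel : nat -> X -> X -> Prop;
  lrel_refl : forall n x, lrel n x x;
  lrel_sym : forall n x y, lrel n x y -> lrel n y x;
  lrel_trans : forall n x y z, lrel n x y -> lrel n y z -> lrel n x z;
  lrel0 : forall x y, lrel 0 x y;
  lrelS : forall n x y, lrel n.+1 x y -> lrel n x y;
  lrel_sep : forall x y, (forall n, lrel n x y) -> x = y;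
  lrel_complete : forall a : nat -> X, (forall n, lrel n (a n) (a n.+1)) ->
    exists x, forall n, lrel n (a n) x }.

Definition witness (T : Type) (t0 : T) (P : T -> Prop) : T :=
  if pselect (exists y, P y) is left h then sval (cid h) else t0.

Lemma witnessP (T : Type) (t0 : T) (P : T -> Prop) y : P y -> P (witness t0 P).
Proof.
by move=> Py; rewrite /witness; case: pselect => [h|[]]; [case: cid | exists y].
Qed.

Section Lipschitz.
Variables (X : Type) (x0 : X) (E : level_structure X).
Local Notation R := (lrel E).

Lemma lrel_le m n x y : m <= n -> R n x y -> R m x y.
Proof.
move=> mn; rewrite -(subnK mn); elim: (n - m) => // d IH.
by move=> h; apply: IH; apply: lrelS; rewrite -addSn.
Qed.

Definition rep n x := witness x0 (R n x).

Lemma repP n x : R n x (rep n x).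
Proof. exact: witnessP (lrel_refl E n x). Qed.

(** [rep] is chosen from the class as a predicate, and related points have extensionally equal
    classes. *)
Lemma rep_eq n x y : R n x y <-> rep n x = rep n y.
Proof.
split=> [xy|e].
  rewrite /rep; congr witness; apply: funext => z; apply: propext; split=> /= h.
    exact: lrel_trans (lrel_sym xy) h.
  exact: lrel_trans xy h.
by apply: lrel_trans (repP n x) _; rewrite e; apply/lrel_sym/repP.
Qed.

Lemma rep_rep m n x : m <= n -> rep m (rep n x) = rep m x.
Proof. by move=> mn; apply/rep_eq; apply: lrel_le mn _; apply/lrel_sym/repP. Qed.

(* At stage [n] of the Lipschitz game, the component [true] belongs to player I
   and is known up to level [uphalf n], and the component [false] belongs to
   player II and is known up to level [n./2]. *)
Definition known (p : bool) n := if p then uphalf n else n./2.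

Lemma known_le p m n : m <= n -> known p m <= known p n.
Proof. by rewrite /known; case: p; lia. Qed.

Lemma knownS p n : odd n = p -> known p n.+1 = known p n.
Proof. by rewrite /known; case: p; lia. Qed.

(** Each component is normalised to the representative of its class, so a position carries no more
    than the classes chosen so far. *)
Definition lpos := {t : nat * (bool -> X) | forall p, rep (known p t.1) (t.2 p) = t.2 p}.

Lemma lpos_eq (t u : lpos) : (sval t).1 = (sval u).1 ->
  (forall p, (sval t).2 p = (sval u).2 p) -> t = u.
Proof.
case: t u => -[n f] h [[m g] h'] /= nm fg; apply: eq_exist.
by congr pair => //; apply: funext.
Qed.

Definition lmk (n : nat) (f : bool -> X) : lpos.
Proof.
exists (n, fun p => rep (known p n) (f p)) => p /=.
by rewrite rep_rep.
Defined.

Definition llev (t : lpos) := (sval t).1.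
Definition lpar (t : lpos) : lpos := lmk (llev t).-1 (sval t).2.
Definition lroot : lpos := lmk 0 (fun=> x0).

Lemma llev_root : llev lroot = 0. Proof. by []. Qed.

Lemma llev0 t : llev t = 0 -> t = lroot.
Proof.
case: t => -[n f] h; rewrite /llev /= => n0; apply: lpos_eq => //= p.
rewrite -[LHS]h /= n0; have -> : known p 0 = 0 by case: (p).
by apply/rep_eq; apply: lrel0.
Qed.

Lemma llev_par t : llev (lpar t) = (llev t).-1. Proof. by []. Qed.

Lemma lchild_ex t : exists u, lpar u = t /\ llev u = (llev t).+1.
Proof.
exists (lmk (llev t).+1 (sval t).2); split=> //; apply: lpos_eq => //= p.
by rewrite rep_rep ?known_le //; case: t => t /= ->.
Qed.

Definition lgame := Game llev_root llev0 llev_par lchild_ex.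

Definition lplay (z : bool -> X) n : lgame := lmk n z.

Definition component (t : lgame) p := (sval t).2 p.

Lemma component_rep (t : lgame) p : rep (known p (lev t)) (component t p) = component t p.
Proof. by case: t => t h; apply: h. Qed.

Lemma component_child (v w : lgame) p :
  child v w -> component v p = rep (known p (lev v)) (component w p).
Proof. by case=> <- lw; rewrite [LHS]/= [lev (par w)]/= /llev. Qed.

Lemma component_play w p m n : play w -> m <= n ->
  component (w m) p = rep (known p m) (component (w n) p).
Proof.
move=> pw; elim: n => [|n IH] mn.
  have -> : m = 0 by lia.
  by rewrite -[LHS]component_rep play_lev.
case: (ltngtP m n.+1) mn => // [mn _|-> _]; last by rewrite -[LHS]component_rep play_lev.
by rewrite IH // (component_child p (play_child n pw)) play_lev // rep_rep // known_le.
Qed.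

Lemma play_lplay w : play w -> exists z, w = lplay z.
Proof.
move=> pw.
have H p : exists x, forall n, component (w n) p = rep (known p n) x.
  pose a j := component (w j.*2) p.
  have kj j : known p j.*2 = j by case: (p) => /=; lia.
  have aj j : a j = rep j (a j.+1).
    by rewrite /a (component_play p pw (n := j.+1.*2)) ?kj //; lia.
  have [j|x xa] := @lrel_complete X E a.
    by apply: lrel_sym; rewrite [a j]aj; apply: repP.
  exists x => n; have nn : n <= n.*2 by lia.
  rewrite (component_play p pw nn); apply/rep_eq.
  by apply: lrel_le (xa n); case: (p) => /=; lia.
have [x Hx] := H true; have [y Hy] := H false.
exists (fun p => if p then x else y); apply: funext => n; apply: lpos_eq.
  exact: (play_lev n pw).
by case; [exact: Hx | exact: Hy].
Qed.

Definition outcome (w : nat -> lgame) : bool -> X :=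
  witness (fun=> x0) (fun z => w = lplay z).

Lemma outcomeE w : play w -> w = lplay (outcome w).
Proof.
by move=> /play_lplay [z wz]; apply: (@witnessP _ _ (fun z => w = lplay z)) wz.
Qed.

Lemma outcome_lrel w w' p n : play w -> play w' -> w n = w' n ->
  R (known p n) (outcome w p) (outcome w' p).
Proof.
move=> pw pw' e; apply/rep_eq.
have H v : play v -> rep (known p n) (outcome v p) = component (v n) p.
  by move=> pv; rewrite [in RHS](outcomeE pv).
by rewrite !H // e.
Qed.

Section Response.
Variables (p : bool) (s : lgame -> lgame).
Hypothesis ss : strat s.

(** [s] is played for [p] against an opponent spelling out [z]. The opponent fills component [p],
    because by [knownS] a move from a level of parity [p] reveals nothing more of it. *)
Fixpoint response (z : X) n : lgame :=
  if n is n'.+1 then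
    if odd n' == p then s (response z n')
    else lmk n'.+1 (fun q => if q == p then z else component (response z n') q)
  else lroot.

Lemma response_inv z n :
  lev (response z n) = n /\ component (response z n) p = rep (known p n) z.
Proof.
elim: n => [|n [ln cn]] /=.
  split=> //; rewrite /component /=; apply/rep_eq.
  by apply: lrel_le (lrel0 E _ _); case: (p).
case: eqP => on; last by rewrite /component /= eqxx.
have ch := ss (response z n); have [_ l1] := ch; rewrite ln in l1; split=> //.
by rewrite -component_rep l1 knownS // -cn (component_child p ch) ln.
Qed.

Lemma response_play z : play (response z).
Proof.
move=> n; have [ln cn] := response_inv z n; split=> //.
rewrite [response z n.+1]/=; case: eqP => on; first by have [] := ss (response z n).
apply: lpos_eq => [|q]; first by rewrite /= -[LHS]/n -[in LHS]ln.
rewrite /= rep_rep ?known_le //; case: eqP => [->|_].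
  by rewrite -[RHS]/(component _ p) cn.
by rewrite -[RHS]/(component _ q) -[in RHS]component_rep ln.
Qed.

Lemma response_follows z : follows p s (response z).
Proof. by move=> n /= /eqP ->. Qed.

Lemma response_local z z' j n : R j z z' -> known p n <= j ->
  response z n = response z' n.
Proof.
move=> zz; elim: n => [|n IH] //= nj.
have e : response z n = response z' n.
  by apply: IH; apply: leq_trans nj; apply: known_le.
rewrite e; case: eqP => // _; apply: lpos_eq => //= q.
by case: eqP => // ->; apply/rep_eq; apply: lrel_le zz.
Qed.

Lemma outcome_response z : outcome (response z) p = z.
Proof.
apply: (@lrel_sep _ E) => n; apply/rep_eq.
have kn : known p n.*2 = n by case: (p) => /=; lia.
have [_] := response_inv z n.*2; rewrite kn => <-.
by rewrite [in RHS](outcomeE (response_play z)) /component /= kn.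
Qed.

End Response.

Local Open Scope classical_set_scope.

Variable Bor : set (set X).

Definition level_open (A : set X) := forall x, A x -> exists n, forall y, R n x y -> A y.

Hypothesis Bor_ind : forall C : set (set X), (forall A, level_open A -> C A) ->
  (forall A, C A -> C (~` A)) ->
  (forall A : nat -> set X, (forall i, C (A i)) -> C (\bigcup_i A i)) ->
  forall A, Bor A -> C A.

Lemma outcome_unravelable p A : Bor A ->
  unravelable (fun w : nat -> lgame => A (outcome w p)).
Proof.
move=> BA; apply: (Bor_ind (C := fun A => unravelable (fun w => A (outcome w p)))) BA.
- move=> {}A oA; apply: unravelable_open => w pw Aw; have [n nA] := oA _ Aw.
  exists n.*2 => w' pw' e; apply: nA; apply: lrel_sym.
  have := outcome_lrel p pw' pw e.
  by have -> : known p n.*2 = n by case: (p) => /=; lia.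
- by move=> {}A; apply: unravelable_setC.
- move=> {}A uA; have := unravelable_bigcup uA; congr unravelable.
  apply: funext => w; apply: propext; split=> [[i h]|[i _ h]]; exists i => //.
Qed.

(** The game is won by player I when membership of the first point in [A] and of the second in [B]
    disagree. A winning strategy of either player becomes a map sending the opponent's point to the
    point produced against it. *)
Theorem Lipschitz_dichotomy A B : Bor A -> Bor B ->
  (exists f, (forall n x y, R n x y -> R n (f x) (f y)) /\
     forall x, A x <-> B (f x)) \/
  (exists f, (forall n x y, R n x y -> R n.+1 (f x) (f y)) /\
     forall x, ~ (A (f x) <-> B x)).
Proof.
move=> BA BB.
have := unravelable_iff (outcome_unravelable true BA) (outcome_unravelable false BB).
move=> /unravelable_setC /unravelable_determined [[s ss sw]|[s ss sw]].
- right; exists (fun z => outcome (response false s z) true); split.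
    move=> n x y xy.
    (* Player I moves first: at stage [n.*2.+1] level [n.+1] of the answer is fixed, while the
       opponent's point is known only to level [n]. *)
    have := @outcome_lrel (response false s x) (response false s y) true n.*2.+1.
    have -> : known true n.*2.+1 = n.+1 by rewrite /=; lia.
    apply; try exact: response_play.
    by apply: (response_local _ (j := n)) xy _; rewrite /=; lia.
  move=> z; have := sw (response false s z); rewrite outcome_response //.
  by apply; [exact: response_play | exact: response_follows].
- left; exists (fun z => outcome (response true s z) false); split.
    move=> n x y xy.
    have := @outcome_lrel (response true s x) (response true s y) false n.*2.
    have -> : known false n.*2 = n by rewrite /=; lia.
    apply; try exact: response_play.
    by apply: (response_local _ (j := n)) xy _; rewrite /=; lia.
  move=> z; have := sw (response true s z); rewrite outcome_response //.
  by move=> h; apply: contrapT; apply: h; [exact: response_play | exact: response_follows].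
Qed.

End Lipschitz.

(** * Flip sets and the Martin-Monk argument *)

Local Open Scope classical_set_scope.

(** * Baire category on the Cantor space *)

Section CantorBaire.
Implicit Types (z y t : nat -> bool) (F : set (nat -> bool)).

Definition agree n z y := forall i, i < n -> z i = y i.

Lemma agree_sym n z y : agree n z y -> agree n y z.
Proof. by move=> h i /h ->. Qed.

Lemma agree_trans n y z t : agree n z y -> agree n y t -> agree n z t.
Proof. by move=> h h' i ni; rewrite h // h'. Qed.

Lemma agree_le m n z y : m <= n -> agree n z y -> agree m z y.
Proof. by move=> mn h i im; apply: h; apply: leq_trans mn. Qed.

(** [F] contains a dense open subset of the cylinder of length [n] around [z]. *)
Definition dense_in n z F := forall m y, n <= m -> agree n z y ->
  exists m' y', [/\ m <= m', agree m y y' & forall t, agree m' y' t -> F t].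

Definition comeager_in n z F := exists D : nat -> set (nat -> bool),
  (forall i, dense_in n z (D i)) /\
  forall t, agree n z t -> (forall i, D i t) -> F t.

(** The Baire property in local form: each cylinder contains one on which [F] is comeager or
    meager. *)
Definition almost_open F := forall n z, exists m y,
  [/\ n <= m, agree n z y & comeager_in m y F \/ comeager_in m y (~` F)].

Lemma comeager_agree n z y F : agree n z y -> comeager_in n z F -> comeager_in n y F.
Proof.
move=> zy [D [dD DF]]; exists D; split=> [i m t nm yt|t yt].
  by apply: dD => //; apply: agree_trans zy yt.
by apply: DF; apply: agree_trans zy yt.
Qed.

(** The Baire category theorem: nested cylinders, the one chosen at step [i] lying inside [D i]. *)
Lemma comeager_in_nonempty n z (D : nat -> set (nat -> bool)) :
  (forall i, dense_in n z (D i)) -> exists2 t, agree n z t & forall i, D i t.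
Proof.
move=> dD.
have step i (c : {c : nat * (nat -> bool) | n <= c.1 /\ agree n z c.2}) :
    exists c' : {c : nat * (nat -> bool) | n <= c.1 /\ agree n z c.2},
    [/\ (sval c).1 < (sval c').1, agree (sval c).1 (sval c).2 (sval c').2 &
      forall t, agree (sval c').1 (sval c').2 t -> D i t].
  case: c => -[m y] /= [nm zy].
  (* Asking for [m.+1] makes the lengths strictly increase, so the cylinders shrink to a single
     point. *)
  have [|m' [y' [mm yy Dy]]] := dD i m.+1 y _ zy; first by lia.
  have h : n <= m' /\ agree n z y'.
    by split; [lia | apply: agree_trans zy _; apply: agree_le yy; lia].
  by exists (exist _ (m', y') h); split=> //=; apply: agree_le yy.
have h0 : n <= n /\ agree n z z by [].
pose c := nat_rect (fun=> {c : nat * (nat -> bool) | n <= c.1 /\ agree n z c.2})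
  (exist _ (n, z) h0) (fun i c => sval (cid (step i c))).
pose m i := (sval (c i)).1; pose y i := (sval (c i)).2.
have cP i : [/\ m i < m i.+1, agree (m i) (y i) (y i.+1) &
    forall t, agree (m i.+1) (y i.+1) t -> D i t].
  by rewrite /m /y /=; case: cid.
have mi i : i <= m i by elim: i => // i IH; have [+ _ _] := cP i; lia.
have mono i j : i <= j -> m i <= m j /\ agree (m i) (y i) (y j).
  move=> ij; rewrite -(subnK ij); elim: (j - i) => // d [mm yy].
  have [m1 y1 _] := cP (d + i); rewrite addSn; split; first by lia.
  by apply: agree_trans yy _; apply: agree_le y1.
pose t k := y k.+1 k.
have yt i : agree (m i) (y i) t.
  move=> k ki; rewrite /t; case: (leqP i k.+1) => ik.
    by have [_] := mono _ _ ik; apply.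
  by have [_ ->] := mono _ _ (ltnW ik); last by apply: mi.
exists t; first exact: (yt 0).
by move=> i; have [_ _] := cP i; apply; apply: yt.
Qed.

Lemma almost_open_setC F : almost_open F -> almost_open (~` F).
Proof.
move=> aF n z; have [m [y [nm zy h]]] := aF n z; exists m, y; split=> //.
by rewrite setCK; case: h; [right | left].
Qed.

Lemma almost_open_open F :
  (forall z, F z -> exists n, forall y, agree n z y -> F y) -> almost_open F.
Proof.
move=> oF n z; have [[t zt Ft]|nF] := pselect (exists2 t, agree n z t & F t).
  have [m mF] := oF t Ft; exists (maxn n m), t; split=> //; first exact: leq_maxl.
  left; exists (fun=> setT); split=> [i k y _ _|y ty _]; first by exists k, y.
  by apply: mF; apply: agree_le ty; apply: leq_maxr.
exists n, z; split=> //; right.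
exists (fun=> setT); split=> [i k y _ _|y ty _]; first by exists k, y.
by move=> Fy; apply: nF; exists y.
Qed.

(* The dense open families of the basic neighbourhoods on which [F] is comeager
   are glued along the least such neighbourhood of each point. *)
Lemma comeager_local n z F :
  (forall m y, n <= m -> agree n z y ->
     exists m' y', [/\ m <= m', agree m y y' & comeager_in m' y' F]) ->
  comeager_in n z F.
Proof.
(* [cut m t] is a canonical centre of the cylinder of length [m] around [t], so the selected family
   depends on the cylinder alone. *)
move=> H; pose cut m t i := if i < m then t i else false.
have cutE m t : agree m t (cut m t) by move=> i im; rewrite /cut im.
have cut_agree m t t' : agree m t t' -> cut m t = cut m t'.
  by move=> tt; apply: funext => i; rewrite /cut; case: ltnP => // /tt.
pose Dsel m y := if pselect (comeager_in m y F) is left h then sval (cid h) else fun=> setT.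
pose least t m := [/\ n <= m, comeager_in m t F &
  forall j, n <= j < m -> ~ comeager_in j t F].
have least_uniq t m m' : least t m -> least t m' -> m = m'.
  move=> [nm cm lm] [nm' cm' lm']; case: (ltngtP m m') => // mm.
    by case: (lm' m); rewrite ?nm.
  by case: (lm m'); rewrite ?nm'.
pose D i : set (nat -> bool) := [set t | exists2 m, least t m & Dsel m (cut m t) i t].
exists D; split=> [i m y nm zy|t zt Dt].
  have [m1 [y1 [mm1 yy1 c1]]] := H m y nm zy.
  have [m0 [nm0 c0 l0]] := first_hit (Q := fun m => comeager_in m y1 F)
    (leq_trans nm mm1) c1.
  have m01 : m0 <= m1 by rewrite leqNgt; apply/negP => lt; apply: (l0 m1) => //; lia.
  have : comeager_in m0 (cut m0 y1) F by apply: comeager_agree c0.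
  move=> c0'; have [dD _] : (forall i, dense_in m0 (cut m0 y1) (Dsel m0 (cut m0 y1) i)) /\
      forall t, agree m0 (cut m0 y1) t -> (forall i, Dsel m0 (cut m0 y1) i t) -> F t.
    by rewrite /Dsel; case: pselect => // h; case: cid.
  have [m2 [y2 [mm2 yy2 D2]]] := dD i m1 y1 m01 (agree_sym (cutE m0 y1)).
  exists m2, y2; split; first by lia.
    by apply: agree_trans yy1 _; apply: agree_le yy2.
  move=> t y2t; exists m0.
    have y1t : agree m0 y1 t.
      apply: agree_trans (agree_le m01 yy2) _; apply: agree_le y2t; lia.
    split=> //; first exact: comeager_agree y1t c0.
    move=> j /andP[nj jm] cj; apply: (l0 j); first by rewrite nj.
    by apply: comeager_agree cj; apply: agree_sym; apply: agree_le y1t; lia.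
  rewrite -(cut_agree m0 y1 t); first exact: D2.
  apply: agree_trans (agree_le m01 yy2) _; apply: agree_le y2t; lia.
have [m lm _] := Dt 0; have [nm cm _] := lm.
have cm' := comeager_agree (cutE m t) cm.
have [_ DF] : (forall i, dense_in m (cut m t) (Dsel m (cut m t) i)) /\
      forall y, agree m (cut m t) y -> (forall i, Dsel m (cut m t) i y) -> F y.
  by rewrite /Dsel; case: pselect => // h; case: cid.
apply: DF; first exact/agree_sym/cutE.
by move=> i; have [m' lm'] := Dt i; rewrite (least_uniq _ _ _ lm' lm).
Qed.

Lemma comeager_bigcap n z (F : nat -> set (nat -> bool)) :
  (forall i, comeager_in n z (F i)) -> comeager_in n z (\bigcap_i F i).
Proof.
move=> cF; have [D HD] := choice cF.
exists (fun k => if unpickle k is Some ij then D ij.1 ij.2 else setT).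
split=> [k|t zt Dt i _].
  case: (unpickle k) => [[i j]|]; first by case: (HD i).
  by move=> m y _ _; exists m, y.
have [_] := HD i; apply=> // j.
by have := Dt (pickle (i, j)); rewrite pickleK.
Qed.

(** If some [F i] is comeager on a smaller cylinder, so is the union. Otherwise every [F i] is
    locally meager, hence meager on the whole cylinder by [comeager_local], and so is the union. *)
Lemma almost_open_bigcup (F : nat -> set (nat -> bool)) :
  (forall i, almost_open (F i)) -> almost_open (\bigcup_i F i).
Proof.
move=> aF n z.
have [[i [m [y [nm zy cF]]]]|nF] := pselect (exists i m y,
    [/\ n <= m, agree n z y & comeager_in m y (F i)]).
  exists m, y; split=> //; left; have [D [dD DF]] := cF; exists D; split=> // t yt Dt.
  by exists i => //; apply: DF.
exists n, z; split=> //; right; rewrite setC_bigcup; apply: comeager_bigcap => i.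
apply: comeager_local => m y nm zy; have [m' [y' [mm yy []]]] := aF i m y.
  move=> c; case: nF; exists i, m', y'; split=> //; first by lia.
  by apply: agree_trans zy _; apply: agree_le yy.
by exists m', y'.
Qed.

Definition flip k z i : bool := if i == k then ~~ z i else z i.

Lemma flipK k z : flip k (flip k z) = z.
Proof. by apply: funext => i; rewrite /flip; case: eqP => // _; rewrite negbK. Qed.

Lemma agree_flip k n z y : agree n z y -> agree n (flip k z) (flip k y).
Proof. by move=> zy i ni; rewrite /flip zy. Qed.

(** Flipping bit [n] is a homeomorphism of the cylinder of length [n], so a comeager set meets its
    flipped image. *)
Lemma comeager_not_flip n z F : comeager_in n z F ->
  ~ forall t, F (flip n t) -> ~ F t.
Proof.
move=> [D [dD DF]] fF.
have agree_nflip t : agree n t (flip n t).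
  by move=> i ni; rewrite /flip; case: eqP => // E; lia.
have dD' i : dense_in n z (D i \o flip n).
  move=> m y nm zy.
  have [m' [y' [mm yy Dy]]] := dD i m (flip n y) nm (agree_trans zy (agree_nflip y)).
  exists m', (flip n y'); split=> //; first by have := agree_flip n yy; rewrite flipK.
  by move=> t /(agree_flip n); rewrite flipK; apply: Dy.
(* The two countable families are interleaved by parity. *)
have [|t zt Dt] := @comeager_in_nonempty n z
    (fun i => if odd i then D i./2 \o flip n else D i./2).
  by move=> i; case: odd.
have zft : agree n z (flip n t) by apply: agree_trans zt _.
apply: (fF t); apply: DF => // i.
  by have := Dt i.*2.+1; rewrite /= odd_double /= uphalf_double.
by have := Dt i.*2; rewrite odd_double doubleK.
Qed.

Lemma almost_open_not_flip F : almost_open F ->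
  ~ forall k t, F (flip k t) <-> ~ F t.
Proof.
move=> aF fF; have [m [y [_ _ [c|c]]]] := aF 0 (fun=> false).
  by apply: comeager_not_flip c _ => t /fF.
apply: comeager_not_flip c _ => t /= nF nFt; apply: nF; exact/fF.
Qed.

End CantorBaire.

(** * The flip set of a chain of contractions *)

Section MartinMonk.
Variables (X : Type) (x0 : X) (E : level_structure X).
Local Notation R := (lrel E).
Variable Bor : set (set X).
Hypothesis Bor_ind : forall C : set (set X), (forall A, level_open E A -> C A) ->
  (forall A, C A -> C (~` A)) ->
  (forall A : nat -> set X, (forall i, C (A i)) -> C (\bigcup_i A i)) ->
  forall A, Bor A -> C A.

Lemma no_contraction_chain (A : nat -> set X) (g : nat -> bool -> X -> X) :
  Bor (A 0) ->
  (forall n e j x y, R j x y -> R j.+1 (g n e x) (g n e y)) ->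
  (forall n x, ~ (A n (g n false x) <-> A n.+1 x)) ->
  (forall n x, A n (g n true x) <-> A n.+1 x) -> False.
Proof.
move=> BA gR gF gT.
(* [it z n j] composes [j] contractions from index [n] on; each gains a level, so [x0] influences
   nothing up to level [j] and the limit exists. *)
pose it := fix it (z : nat -> bool) n j : X :=
  if j is j'.+1 then g n (z n) (it z n.+1 j') else x0.
have itR z j n : R j (it z n j) (it z n j.+1).
  by elim: j n => [|j IH] n; [exact: lrel0 | apply: gR; apply: IH].
have [x xR] : exists x : (nat -> bool) -> nat -> X,
    forall z n j, R j (it z n j) (x z n).
  have [zn|x xR] := @choice ((nat -> bool) * nat) X
      (fun zn x => forall j, R j (it zn.1 zn.2 j) x).
    exact: (lrel_complete (fun j => itR zn.1 j zn.2)).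
  by exists (fun z n => x (z, n)) => z n; apply: (xR (z, n)).
have xE z n : x z n = g n (z n) (x z n.+1).
  apply: (@lrel_sep _ E) => j; apply: lrelS.
  by apply: lrel_trans (lrel_sym (xR z n j.+1)) _; apply: gR.
have it_agree j n z y : (forall i, n <= i < n + j -> z i = y i) -> it z n j = it y n j.
  elim: j n => // j IH n zy /=; rewrite zy; last by lia.
  by congr g; apply: IH => i ij; apply: zy; lia.
have x_agree n z y : (forall i, n <= i -> z i = y i) -> x z n = x y n.
  move=> zy; apply: (@lrel_sep _ E) => j.
  apply: lrel_trans (lrel_sym (xR z n j)) _.
  by rewrite (it_agree j n z y) // => i /andP[ni _]; apply: zy.
pose F : set (nat -> bool) := [set z | A 0 (x z 0)].
apply: (@almost_open_not_flip F).
  apply: (Bor_ind (C := fun B => almost_open [set z | B (x z 0)])) BA.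
  - move=> B oB; apply: almost_open_open => z /oB [n nB]; exists n => y zy.
    apply: nB; apply: lrel_trans (lrel_sym (xR z 0 n)) _.
    by rewrite (it_agree n 0 z y) // => i /andP[_ ni]; apply: zy.
  - by move=> B; apply: almost_open_setC.
  - by move=> B aB; apply: (almost_open_bigcup aB).
have AE z n : A n (x z n) <-> (if z n then A n.+1 (x z n.+1) else ~ A n.+1 (x z n.+1)).
  rewrite xE; case: (z n); first exact: gT.
  have := gF n (x z n.+1); have [|] := pselect (A n.+1 (x z n.+1)).
    by tauto.
  by have [|] := pselect (A n (g n false (x z n.+1))); tauto.
move=> k t.
(* The point at index [k.+1] does not see bit [k], and the flip exchanges the map preserving
   membership with the one reversing it. *)
have top : A k (x (flip k t) k) <-> ~ A k (x t k).
  rewrite (AE (flip k t)) (AE t); have -> : x (flip k t) k.+1 = x t k.+1.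
    by apply: x_agree => i ki; rewrite /flip; case: eqP => // e; lia.
  have -> : flip k t k = ~~ t k by rewrite /flip eqxx.
  case: (t k) => /=; first by tauto.
  by have [|] := pselect (A k.+1 (x t k.+1)); tauto.
(* The bits below [k] are unchanged, so the negation is carried down from index [k] to index 0. *)
suff : forall d, d <= k -> (A (k - d) (x (flip k t) (k - d)) <-> ~ A (k - d) (x t (k - d))).
  by move=> /(_ k (leqnn k)); rewrite subnn.
elim=> [_|d IH dk]; first by rewrite subn0.
have e : (k - d.+1).+1 = k - d by lia.
rewrite (AE (flip k t)) (AE t) e; have -> : flip k t (k - d.+1) = t (k - d.+1).
  by rewrite /flip; case: eqP => // ?; lia.
by have := IH (ltnW dk); case: (t _); tauto.
Qed.

End MartinMonk.

(** * Ultrametric spaces *)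

Import Order.TTheory GRing.Theory Num.Theory.
Import numFieldNormedType.Exports.
Local Open Scope ring_scope.

Section Ultrametric.
Context {R : realType} (X : metricType R).

Definition radii (r : nat -> R) :=
  [/\ forall n, 0 <= r n, forall n, r n.+1 <= r n,
      forall x y : X, x <> y -> exists n, mdist x y = r n
    & forall e, 0 < e -> exists n, r n < e].

(** The distances are sorted decreasingly; the default value 0 of [nth] continues the list to an
    infinite sequence and supplies the arbitrarily small radii. *)
Lemma radii_finite : finite_set (nonzero_distances X) -> exists r, radii r.
Proof.
move=> /finite_seqP [s Es]; pose t := sort >=%O s.
have t_ge0 a : a \in t -> 0 <= a.
  rewrite mem_sort => sa; have : nonzero_distances X a by rewrite Es.
  by move=> [x [y [_ ->]]]; apply: mdist_ge0.
have nth_t n : 0 <= nth 0 t n.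
  by case: (ltnP n (size t)) => nt; [exact/t_ge0/mem_nth | rewrite nth_default].
exists (nth 0 t); split=> // [n|x y xy|e e0].
- have [nt|nt] := ltnP n.+1 (size t); last by rewrite nth_default.
  have so : sorted >=%O t by apply: sort_sorted => a b; apply: ge_total.
  by have /sortedP -/(_ 0 n nt) := so.
- have : nonzero_distances X (mdist x y) by exists x, y.
  rewrite Es /= -(mem_sort >=%O) => st; exists (index (mdist x y) t).
  by rewrite nth_index.
- by exists (size t); rewrite nth_default.
Qed.

Lemma radii_sequence (r : nat -> R) : decreasing_seq r -> r @ \oo --> (0 : R) ->
  nonzero_distances X = range r -> radii r.
Proof.
move=> dr r0 Er; split=> [n|n|x y xy|e e0].
- have : nonzero_distances X (r n) by rewrite Er; exists n.
  by move=> [x [y [_ ->]]]; apply: mdist_ge0.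
- by rewrite dr.
- have : nonzero_distances X (mdist x y) by exists x, y.
  by rewrite Er => -[n _ <-]; exists n.
- move/cvgrPdist_lt : r0 => /(_ e e0) [N _ /(_ N (leqnn N))] /=.
  by rewrite sub0r normrN => h; exists N; apply: le_lt_trans (ler_norm _) h.
Qed.

Variables (r : nat -> R) (rr : radii r).
Hypothesis hX : ultrametric_Polish X.

Let um (x y z : X) : mdist x z <= Num.max (mdist x y) (mdist y z).
Proof. by have [_ + _] := hX; apply. Qed.

Lemma radii_le m n : (m <= n)%N -> r n <= r m.
Proof.
have [_ rS _ _] := rr => mn; rewrite -(subnK mn).
by elim: (n - m)%N => // d; apply: le_trans; apply: rS.
Qed.

Lemma radii_bound (x y : X) : mdist x y <= r 0%N.
Proof.
have [r_ge0 _ rX _] := rr; have [->|xy] := pselect (x = y); first by rewrite mdistxx.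
by have [n ->] := rX x y xy; apply: radii_le.
Qed.

Lemma radii_trans n (x y z : X) :
  mdist x y <= r n -> mdist y z <= r n -> mdist x z <= r n.
Proof. by move=> xy yz; apply: le_trans (um x y z) _; rewrite ge_max xy. Qed.

Lemma radii_sep (x y : X) : (forall n, mdist x y <= r n) -> x = y.
Proof.
have [_ _ _ r_small] := rr => xy; apply: contrapT => /eqP; rewrite -mdist_gt0.
by move=> /r_small [n]; rewrite ltNge xy.
Qed.

Lemma radii_complete (a : nat -> X) : (forall n, mdist (a n) (a n.+1) <= r n) ->
  exists x, forall n, mdist (a n) x <= r n.
Proof.
move=> ar; have [r_ge0 _ _ r_small] := rr; have [_ _ cX] := hX.
have amn m n : (m <= n)%N -> mdist (a m) (a n) <= r m.
  move=> mn; rewrite -(subnK mn); elim: (n - m)%N => [|d IH].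
    by rewrite add0n mdistxx.
  apply: radii_trans IH _; apply: le_trans (ar _) _; apply: radii_le.
  exact: leq_addl.
have [|l al] := cX a.
  apply/cauchy_ballP => e /r_small [N rN].
  exists (a @` [set n | (N <= n)%N], a @` [set n | (N <= n)%N]) => /=.
    by split; exists N => // n /= Nn; exists n.
  move=> [_ _] /= [[i /= Ni <-] [j /= Nj <-]]; rewrite ballEmdist /=.
  apply: le_lt_trans rN; apply: (@radii_trans _ _ (a N)); last exact: amn.
  by rewrite metric_sym; apply: amn.
(* A late term is within [r n] of [a n] and nearer to [l] than [a n] is; the ultrametric inequality
   would make the distance from [a n] to [l] smaller than itself. *)
exists l => n; rewrite leNgt; apply/negP => rl.
have l_gt0 : 0 < mdist (a n) l by apply: le_lt_trans rl.
have [N _ aN] := metricType_numDomainType.cvgr_dist_lt al l_gt0.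
have := aN (maxn n N) (leq_maxr _ _); rewrite /= metric_sym => h.
have := um (a n) (a (maxn n N)) l; rewrite leNgt gt_max h andbT.
by rewrite (le_lt_trans (amn _ _ (leq_maxl _ _)) rl).
Qed.

Definition ultrametric_levels : level_structure X.
Proof.
exists (fun n (x y : X) => mdist x y <= r n).
- by move=> n x; rewrite mdistxx; case: rr.
- by move=> n x y; rewrite metric_sym.
- by move=> n x y z; apply: radii_trans.
- exact: radii_bound.
- by move=> n x y h; apply: le_trans h _; case: rr.
- exact: radii_sep.
- exact: radii_complete.
Defined.

Lemma open_level_open (A : set X) : open A -> level_open ultrametric_levels A.
Proof.
have [_ _ _ r_small] := rr.
rewrite openE => oA x /oA /nbhs_ballP [e /= /r_small [n rn] eA].
by exists n => y /= xy; apply: eA; rewrite ballEmdist /=; apply: le_lt_trans rn.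
Qed.

(** Every nonzero distance is itself one of the radii, so preserving the levels bounds it
    exactly. *)
Lemma levels_nonexpansive (f : X -> X) :
  (forall n x y, lrel ultrametric_levels n x y -> lrel ultrametric_levels n (f x) (f y)) ->
  nonexpansive X f.
Proof.
move=> fR x y; have [->|xy] := pselect (x = y); first by rewrite !mdistxx.
have [_ _ rX _] := rr; have [n e] := rX x y xy; rewrite e; apply: fR => /=.
by rewrite e.
Qed.

Lemma Borel_level_ind (C : set (set X)) :
  (forall A, level_open ultrametric_levels A -> C A) ->
  (forall A, C A -> C (~` A)) ->
  (forall A : nat -> set X, (forall i, C (A i)) -> C (\bigcup_i A i)) ->
  forall A, Borel X A -> C A.
Proof.
move=> Co CC CU A; apply: smallest_sub; last by move=> B /open_level_open /Co.
by split=> [|B CB|]; [apply: Co | rewrite setTD; apply: CC | exact: CU].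
Qed.

End Ultrametric.

(** * The hierarchy on the Borel sets *)

Lemma BorelC (R : realType) (X : metricType R) (A : set X) :
  Borel X A -> Borel X (~` A).
Proof.
by have [_ + _] := smallest_sigma_algebra [set: X] (@open X) => /[apply]; rewrite setTD.
Qed.

Lemma reducible_comp (X : Type) (F : set (X -> X)) (A B C : set X) :
  (forall f g, F f -> F g -> F (g \o f)) ->
  reducible F A B -> reducible F B C -> reducible F A C.
Proof. by move=> FF [f Ff ->] [g Fg ->]; exists (g \o f) => //; apply: FF. Qed.

Lemma reducibleC (X : Type) (F : set (X -> X)) (A B : set X) :
  reducible F A B -> reducible F (~` A) (~` B).
Proof. by move=> [f Ff ->]; exists f. Qed.

Theorem theorem4p7 (R : realType) (X : metricType R)
  (hX : ultrametric_Polish X)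
  (hR : finite_set (nonzero_distances X) \/
        exists r : nat -> R,
          [/\ decreasing_seq r, r @ \oo --> (0 : R)
            & nonzero_distances X = range r]) :
  very_good (nonexpansive X) (Borel X).
Proof.
have [r rr] : exists r, radii X r.
  case: hR => [|[r [? ? ?]]]; first exact: radii_finite.
  by exists r; apply: radii_sequence.
(* The Lipschitz game needs a base point. On the empty space the identity reduces any set to any
   other. *)
have [[x0 _]|X0] := pselect (exists x : X, True); last first.
  have AB (A B : set X) : reducible (nonexpansive X) A B.
    by exists id => //; apply/seteqP; split=> x; case: X0; exists x.
  by split=> [A B _ _|[A [_ /(_ 0%N) [_ []]]]]; [left | ].
pose E := ultrametric_levels rr hX.
have dichotomy (A B : set X) : Borel X A -> Borel X B ->
    reducible (nonexpansive X) A B \/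
    exists f, (forall n x y, lrel E n x y -> lrel E n.+1 (f x) (f y)) /\
      forall x, ~ (A (f x) <-> B x).
  move=> BA BB.
  have [[f [fR fAB]]|] := Lipschitz_dichotomy x0 (@Borel_level_ind R X r rr hX) BA BB.
    left; exists f; first exact: levels_nonexpansive fR.
    by apply/seteqP; split=> x /fAB.
  by right.
have comp_ne f g : nonexpansive X f -> nonexpansive X g -> nonexpansive X (g \o f).
  by move=> hf hg x y; apply: le_trans (hg _ _) (hf _ _).
split=> [A B BA BB|[A [BA Adec]]].
  have [|[f [fR fAB]]] := dichotomy A B BA BB; first by left.
  right; exists f.
    by apply: (@levels_nonexpansive R X r rr hX) => n x y /fR; apply: lrelS.
  apply/seteqP; split=> x /=; have := fAB x;
    by have [|] := pselect (A (f x)); have [|] := pselect (B x); tauto.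
have chain n : exists g : bool -> X -> X,
    [/\ forall e j x y, lrel E j x y -> lrel E j.+1 (g e x) (g e y),
        forall x, ~ (A n (g false x) <-> A n.+1 x)
      & forall x, A n (g true x) <-> A n.+1 x].
  have [A1 nA] := Adec n.
  have [//|[g0 [g0R g0A]]] := dichotomy _ _ (BA n) (BA n.+1).
  have [ABC|[g1 [g1R g1A]]] := dichotomy _ _ (BA n) (BorelC (BA n.+1)).
    (* From [A n.+1] below [A n] and [A n] below the complement of [A n.+1], the set [A n.+1] is
       below its complement; complementing gives [A n] below [A n.+1], against strictness. *)
    case: nA; apply: reducible_comp (ABC) _ => //.
    rewrite -[A n.+1 in X in reducible _ _ X]setCK; apply: reducibleC.
    exact: reducible_comp A1 ABC.
  (* The map won against the complement of [A n.+1] preserves membership, so it serves the bit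
     [true]. *)
  exists (fun e => if e then g1 else g0); split=> // [[]|x] //=.
  by have := g1A x; rewrite /setC /=; have [|] := pselect (A n (g1 x));
    have [|] := pselect (A n.+1 x); tauto.
have [g gP] := choice chain.
apply: (@no_contraction_chain X x0 E (Borel X) (Borel_level_ind (hX := hX)) A g) => //.
- by move=> n; have [+ _ _] := gP n.
- by move=> n; have [_ + _] := gP n.
- by move=> n; have [_ _ +] := gP n.
Qed.
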